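(* Let $\beta>7$ and $w(v,I)=(1+|v|+\sqrt I)^\beta$. There exists a constant $C>0$ such that for every measurable function $f=f(t,x,v,I)$ with $\|wf(t)\|_{L^\infty}<\infty$, and for all $(t,x,v,I)$, $$\bigl|w(v,I)\,\Gamma_+(f,f)(t,x,v,I)\bigr|\le\frac{C\,\|wf(t)\|_{L^\infty}}{1+|v|+I^{1/4}}\left(\int_{\mathbb R^3\times\mathbb R_+}(1+|v_*|+\sqrt{I_*})^{-2\beta+8}\,|w(v_*,I_* )f(t,x,v_*,I_* )|^2\,dv_*\,dI_*\right)^{1/2}.$$
   Context: Fix $\alpha\in[0,2)$, $\delta\ge 2$, and a constant $C_B>0$. $\mathbb R_+=(0,\infty)$; variables $t\ge0$, $x\in\mathbb T^3$, $v\in\mathbb R^3$, $I\in\mathbb R_+$. $\|\cdot\|_{L^\infty}$ is the $L^\infty$ norm over $(x,v,I)\in\mathbb T^3\times\mathbb R^3\times\mathbb R_+$; pointwise inequalities are understood for almost every $(x,v,I)$. Collisions. For $(v,I),(v_*,I_* )\in\mathbb R^3\times\mathbb R_+$ put $E=\frac{|v-v_*|^2}{4}+I+I_*$. For $\omega\in\mathbb S^2$, $R,r\in[0,1]$ put $v'=\frac{v+v_*}{2}+\sqrt{RE}\,\omega$, $v_*'=\frac{v+v_*}{2}-\sqrt{RE}\,\omega$, $I'=r(1-R)E$, $I_*'=(1-r)(1-R)E$. Gain part of the collision operator. With $B=C_B\left(\frac{|v-v_*|^2}{4}+I+I_*\right)^{\frac{2-\alpha}{2}}$, $$Q_+(F,G)=\int_{\mathbb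 S^2\times[0,1]^2\times\mathbb R^3\times\mathbb R_+}B\,\frac{F'G'_*}{(I'I'_* )^{\delta/2-1}}(r(1-r))^{\delta/2-1}(1-R)^{\delta-1}R^{1/2}(II_* )^{\delta/2-1}\,d\omega\,dR\,dr\,dv_*\,dI_*,$$ where $F'=F(t,x,v',I')$, $G'_*=G(t,x,v'_*,I'_* )$. Equivalently (up to the value of the positive constant), $Q_+(F,G)=\int_{(\mathbb R^3\times\mathbb R_+)^3}W\frac{F'G'_*}{(I'I'_* )^{\delta/2-1}}\,dv_*dv'dv'_*dI_*dI'dI'_*$ with $W=\text{const}\cdot\frac{(II_*I'I'_* )^{\delta/2-1}}{E^{\delta+(\alpha-1)/2}}\,\delta_3(v+v_*-v'-v'_* )\,\delta_1\left(\frac{|v|^2}{2}+\frac{|v_*|^2}{2}+I+I_*-\frac{|v'|^2}{2}-\frac{|v'_*|^2}{2}-I'-I'_*\right)$, $\delta_3,\delta_1$ Dirac deltas. Global Maxwellian: $M(v,I)=\frac{I^{\delta/2-1}}{(2\pi)^{3/2}\Gamma(\delta/2)}e^{-|v|^2/2-I}$, with $\Gamma(\delta/2)$ the gamma function. Nonlinear gain term: $\Gamma_+(f,f)=\frac{1}{\sqrt M}Q_+(\sqrt Mf,\sqrt Mf)$. The constant $C$ in the claim may depend on $\alpha,\delta,\beta,C_B$ only. *)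

(* Defs.v *)
From HB Require Import structures.
From mathcomp Require Import all_boot all_order all_algebra.
From mathcomp Require Import all_classical all_reals all_analysis.
From mathcomp Require Import measurable_realfun.

Set Implicit Arguments.
Unset Strict Implicit.
Unset Printing Implicit Defensive.

Import Order.TTheory GRing.Theory Num.Def Num.Theory.
Import numFieldNormedType.Exports.

Local Open Scope classical_set_scope.
Local Open Scope ring_scope.

(* An alias of [\x]: on [m1 \x m2] itself, canonical inference of the
   sigma-finite structure selects the instance for subprobabilities and
   fails, so that products of three or more measures do not typecheck. *)
Section sigma_finite_product.
Context d1 d2 (T1 : measurableType d1) (T2 : measurableType d2) (R : realType).

Definition sigma_prod (m1 : set T1 -> \bar R) (m2 : set T2 -> \bar R) :
  set (T1 * T2) -> \bar R := (m1 \x m2)%E.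

Variable m1 : {sigma_finite_measure set T1 -> \bar R}.
Variable m2 : {sigma_finite_measure set T2 -> \bar R}.

HB.instance Definition _ := Measure.on (sigma_prod m1 m2).

Let sigma_finite_sigma_prod : sigma_finite setT (sigma_prod m1 m2).
Proof.
have /sigma_finiteP[F [TF ndF Foo]] := sigma_finiteT m1.
have /sigma_finiteP[G [TG ndG Goo]] := sigma_finiteT m2.
exists (fun n => F n `*` G n).
  rewrite -setXTT TF TG predeqE => -[x y]; split.
    move=> [/= [n _ Fnx] [k _ Gky]]; exists (maxn n k) => //; split.
    - by move: x Fnx; exact/subsetPset/ndF/leq_maxl.
    - by move: y Gky; exact/subsetPset/ndG/leq_maxr.
  by move=> [n _ []/= ? ?]; split; exists n.
move=> k; have [? ?] := Foo k; have [? ?] := Goo k.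
split; first exact: measurableX.
by rewrite /sigma_prod product_measure1E// lte_mul_pinfty// ge0_fin_numE.
Qed.

HB.instance Definition _ := Measure_isSigmaFinite.Build _ _ _
  (sigma_prod m1 m2) sigma_finite_sigma_prod.

End sigma_finite_product.

Notation "m1 '\xs' m2" := (sigma_prod m1 m2)
  (at level 40, left associativity) : ereal_scope.

Section euclidean_space.
Context {R : realType}.
Local Notation mR := (measurableTypeR R).

(* The norm that the library puts on a product is the sup norm. *)
Definition norm3 (v : R * R * R) : R :=
  Num.sqrt (v.1.1 ^+ 2 + v.1.2 ^+ 2 + v.2 ^+ 2).

Definition scale3 (a : R) (v : R * R * R) : R * R * R :=
  (a * v.1.1, a * v.1.2, a * v.2).

Definition leb3 : set (mR * mR * mR) -> \bar R :=
  (@lebesgue_measure R \xs @lebesgue_measure R \xs @lebesgue_measure R)%E.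

HB.instance Definition _ := SigmaFiniteMeasure.on leb3.


Lemma measurable_norm3 : measurable_fun [set: R * R * R] norm3.
Proof.
apply: (@measurableT_comp _ _ _ _ _ _ (@Num.sqrt R)).
  by apply: continuous_measurable_fun; exact: sqrt_continuous.
apply: measurable_funD; first apply: measurable_funD.
- exact/measurable_funX/measurableT_comp.
- exact/measurable_funX/measurableT_comp.
- exact/measurable_funX.
Qed.

Lemma measurable_normalize3 :
  measurable_fun [set: R * R * R] (fun v => scale3 (norm3 v)^-1 v).
Proof.
have mN : measurable_fun [set: R * R * R] (fun v => (norm3 v)^-1).
  rewrite (_ : (fun v => _) = (fun v => norm3 v `^ (-1))).
    exact: (measurableT_comp (measurable_powR (-1)) measurable_norm3).
  by apply/funext => v; rewrite powR_inv1// sqrtr_ge0.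
apply/measurable_fun_pairP; split; first apply/measurable_fun_pairP; first split.
- by apply: measurable_funM => //; exact: measurableT_comp.
- by apply: measurable_funM => //; exact: measurableT_comp.
- exact: measurable_funM.
Qed.

Definition unit_sphere : set (R * R * R) := [set omega | norm3 omega = 1].

(* The cone {s omega | omega \in A, 0 < s <= 1} over A. *)
Definition unit_cone (A : set (mR * mR * mR)) : set (mR * mR * mR) :=
  [set y : R * R * R | 0 < norm3 y <= 1 /\ A (scale3 (norm3 y)^-1 y)].

(* Surface measure on the unit sphere of R^3, extended by 0 to R^3: the measure
   of A is 3 times the volume of the cone over A. It is the measure of the polar
   coordinates formula
   \int g dx = \int_0^oo \int_{S^2} g (s omega) s^2 domega ds. *)
Definition sphere_measure (A : set (mR * mR * mR)) : \bar R :=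
  (3%:E * leb3 (unit_cone A))%E.

Let measurable_cone A : measurable A -> measurable (unit_cone A).
Proof.
move=> mA.
rewrite (_ : unit_cone A = (setT `&` norm3 @^-1` `]0, 1]) `&`
   (setT `&` (fun v : R * R * R => scale3 (norm3 v)^-1 v) @^-1` A)); last first.
  by rewrite !setTI; apply/seteqP; split => y; rewrite /unit_cone /= in_itv.
by apply: measurableI; [exact: measurable_norm3|exact: measurable_normalize3].
Qed.

Let sphere_measure0 : sphere_measure set0 = 0%E.
Proof.
rewrite /sphere_measure (_ : unit_cone set0 = set0) ?measure0 ?mule0//.
by apply/seteqP; split => y // [].
Qed.

Let sphere_measure_ge0 A : (0 <= sphere_measure A)%E.
Proof. by rewrite /sphere_measure mule_ge0// lee_fin. Qed.

Let sphere_measure_sigma_additive : semi_sigma_additive sphere_measure.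
Proof.
move=> F mF tF mUF.
have -> : (fun n => \sum_(0 <= i < n) sphere_measure (F i))%E =
    (fun n => 3%:E * \sum_(0 <= i < n) leb3 (unit_cone (F i)))%E.
  by apply/funext => n; rewrite ge0_sume_distrr.
apply: cvgeZl => //.
rewrite /sphere_measure.
have -> : unit_cone (\bigcup_n F n) = \bigcup_n unit_cone (F n).
  apply/seteqP; split => y /=; first by move=> [y1 [n _ Fy]]; exists n.
  by move=> [n _ [y1 Fy]]; split => //; exists n.
apply: (@measure_sigma_additive _ _ _ leb3) => [n|].
  exact: measurable_cone.
apply/trivIsetP => i j _ _ ij; apply/seteqP; split => y // -[[_ Fi] [_ Fj]].
move/trivIsetP : tF => /(_ i j Logic.I Logic.I ij) /seteqP[FF _].
exact: (FF (scale3 (norm3 y)^-1 y)).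
Qed.

HB.instance Definition _ := isMeasure.Build _ _ _ sphere_measure
  sphere_measure0 sphere_measure_ge0 sphere_measure_sigma_additive.

Let sphere_measure_fin : fin_num_fun sphere_measure.
Proof.
move=> A mA; rewrite ge0_fin_numE// /sphere_measure lte_mul_pinfty//.
pose I11 : set mR := `[(-1 : R), 1]%classic.
have mI : measurable I11 by exact: measurable_itv.
have mII : measurable (I11 `*` I11) by exact: measurableX.
have I11oo : (@lebesgue_measure R I11 < +oo)%E.
  by rewrite /I11 lebesgue_measure_itv/= lte_fin; case: ifP => // _; exact: ltry.
have I11fin : @lebesgue_measure R I11 \is a fin_num.
  by rewrite ge0_fin_numE// measure_ge0.
have I22fin : (@lebesgue_measure R \x @lebesgue_measure R)%E (I11 `*` I11)
    \is a fin_num.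
  by rewrite product_measure1E// fin_numM.
have : (leb3 (I11 `*` I11 `*` I11) < +oo)%E.
  rewrite /leb3 /sigma_prod product_measure1E//.
  by apply: lte_mul_pinfty => //; exact: measure_ge0.
apply: le_lt_trans; apply: le_measure; rewrite ?inE.
- exact: measurable_cone.
- exact: measurableX.
move=> y [/andP[_ y1] _].
have sub1 (a b : R) : 0 <= b -> a ^+ 2 + b <= 1 -> -1 <= a <= 1.
  move=> b0 ab1; rewrite -ler_norml -(@expr_le1 _ 2)// real_normK ?num_real//.
  by rewrite (le_trans _ ab1)// lerDl.
have {}y1 : y.1.1 ^+ 2 + y.1.2 ^+ 2 + y.2 ^+ 2 <= 1.
  rewrite -(@sqr_sqrtr _ (_ + _ + _)) ?addr_ge0 ?sqr_ge0//.
  by rewrite expr_le1// sqrtr_ge0.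
split; first split; rewrite /I11 /= in_itv/=.
- by apply: (sub1 _ (y.1.2 ^+ 2 + y.2 ^+ 2)); rewrite ?addr_ge0 ?sqr_ge0// addrA.
- apply: (sub1 _ (y.1.1 ^+ 2 + y.2 ^+ 2)); rewrite ?addr_ge0 ?sqr_ge0//.
  by rewrite addrCA addrA.
- by apply: (sub1 _ (y.1.1 ^+ 2 + y.1.2 ^+ 2)); rewrite ?addr_ge0 ?sqr_ge0// addrC.
Qed.

HB.instance Definition _ := Measure_isFinite.Build _ _ _
  sphere_measure sphere_measure_fin.

End euclidean_space.

Section phase_space.
Context {R : realType}.
Local Notation mR := (measurableTypeR R).

(* Fundamental domain of the torus R^3 / Z^3. *)
Definition unit_cube : set (R * R * R) :=
  `[0, 1[%classic `*` `[0, 1[%classic `*` `[0, 1[%classic.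

(* Functions on the torus are Z^3-periodic functions of x : R * R * R. *)
Definition torus_periodic (f : R -> R * R * R -> R * R * R -> R -> R) : Prop :=
  forall (t : R) (x v : R * R * R) (I : R) (k : int * int * int),
    0 <= t -> 0 < I ->
    f t (x + (k.1.1%:~R, k.1.2%:~R, k.2%:~R)) v I = f t x v I.

(* Points are ((x, v), I). *)
Definition phase_domain : set ((mR * mR * mR) * (mR * mR * mR) * mR) :=
  unit_cube `*` setT `*` `]0, +oo[%classic.

Lemma measurable_phase_domain : measurable phase_domain.
Proof.
apply: measurableX; last exact: measurable_itv.
apply: measurableX => //; apply: measurableX; last exact: measurable_itv.
by apply: measurableX; exact: measurable_itv.
Qed.

Definition phase_measure : set ((mR * mR * mR) * (mR * mR * mR) * mR) -> \bar R :=
  mrestr (@leb3 R \xs @leb3 R \xs @lebesgue_measure R)%E measurable_phase_domain.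

HB.instance Definition _ := Measure.on phase_measure.

Definition weight (beta : R) (v : R * R * R) (I : R) : R :=
  (1 + norm3 v + Num.sqrt I) `^ beta.

Definition weighted_Linfty (beta : R)
    (f : R -> R * R * R -> R * R * R -> R -> R) (t : R) : \bar R :=
  ('N[phase_measure]_+oo[(fun z =>
    (weight beta z.1.2 z.2 * f t z.1.1 z.1.2 z.2)%:E)])%E.

End phase_space.

Section collisions.
Context {R : realType}.
Local Notation mR := (measurableTypeR R).
Implicit Types (v vs omega x : R * R * R) (I Is r t : R).

Definition energy v I vs Is : R := norm3 (v - vs) ^+ 2 / 4 + I + Is.

(* The parameter written R in the Borgnakke-Larsen parametrization is [q]. *)
Definition post_v v I vs Is omega (q : R) : R * R * R :=
  scale3 2^-1 (v + vs) + scale3 (Num.sqrt (q * energy v I vs Is)) omega.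

Definition post_vs v I vs Is omega (q : R) : R * R * R :=
  scale3 2^-1 (v + vs) - scale3 (Num.sqrt (q * energy v I vs Is)) omega.

Definition post_I v I vs Is (q : R) r : R :=
  r * (1 - q) * energy v I vs Is.

Definition post_Is v I vs Is (q : R) r : R :=
  (1 - r) * (1 - q) * energy v I vs Is.

Definition cross_section (alpha CB : R) v I vs Is : R :=
  CB * energy v I vs Is `^ ((2 - alpha) / 2).

Definition gain_integrand (alpha delta CB : R)
    (F G : R -> R * R * R -> R * R * R -> R -> R) t x v I
    omega (q : R) r vs Is : R :=
  let v' := post_v v I vs Is omega q in
  let vs' := post_vs v I vs Is omega q in
  let I' := post_I v I vs Is q r in
  let Is' := post_Is v I vs Is q r in
  cross_section alpha CB v I vs Is *
  (F t x v' I' * G t x vs' Is' / (I' * Is') `^ (delta / 2 - 1)) *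
  (r * (1 - r)) `^ (delta / 2 - 1) * (1 - q) `^ (delta - 1) * q `^ 2^-1 *
  (I * Is) `^ (delta / 2 - 1).

(* Points are (((omega, (q, r)), vs), Is). *)
Definition collision_domain :
    set ((mR * mR * mR) * (mR * mR) * (mR * mR * mR) * mR) :=
  unit_sphere `*` (`[0, 1]%classic `*` `[0, 1]%classic) `*` setT `*`
  `]0, +oo[%classic.

Definition collision_measure :
    set ((mR * mR * mR) * (mR * mR) * (mR * mR * mR) * mR) -> \bar R :=
  (@sphere_measure R \xs (@lebesgue_measure R \xs @lebesgue_measure R) \xs
   @leb3 R \xs @lebesgue_measure R)%E.

HB.instance Definition _ := SigmaFiniteMeasure.on collision_measure.

(* Extended-real valued: if the integral does not converge absolutely, then
   the value is infinite. *)
Definition Qplus (alpha delta CB : R)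
    (F G : R -> R * R * R -> R * R * R -> R -> R) t x v I : \bar R :=
  (\int[collision_measure]_(p in collision_domain)
    (gain_integrand alpha delta CB F G t x v I
      p.1.1.1 p.1.1.2.1 p.1.1.2.2 p.1.2 p.2)%:E)%E.

Definition Euler_gamma (a : R) : R :=
  \int[@lebesgue_measure R]_(s in `]0, +oo[) (s `^ (a - 1) * expR (- s)).

Definition maxwellian (delta : R) v I : R :=
  I `^ (delta / 2 - 1) / ((2 * pi) `^ (3 / 2) * Euler_gamma (delta / 2)) *
  expR (- (norm3 v ^+ 2 / 2) - I).

Definition Gamma_plus (alpha delta CB : R)
    (f g : R -> R * R * R -> R * R * R -> R -> R) t x v I : \bar R :=
  let sqrtM f t x v I := Num.sqrt (maxwellian delta v I) * f t x v I in
  ((Num.sqrt (maxwellian delta v I))^-1%:E *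
   Qplus alpha delta CB (sqrtM f) (sqrtM g) t x v I)%E.

End collisions.

(* Main.v *)
(* Energy conservation turns the Maxwellians in Gamma_+ into a factor bounded by
   E^((2 - alpha)/2) (1 - q) sqrt q e^(-|vs|^2/4 - Is/2) Is^((delta/2 - 1)/2), and
   gives w <= 3^beta max (w', ws'), so that w |f' fs'| <= 3^beta L (|f'| + |fs'|) with
   L the weighted sup norm. For fixed (vs, Is) the change of variables from
   (omega, q, r) to (v', I') has Jacobian E^(5/2) (1 - q) sqrt q / 2, hence the
   angular integral is at most C E^(-5/2) times the L^1 norm of f(t, x, .). The
   remaining kernel E^(-(3 + alpha)/2), against the Gaussian in (vs, Is), has
   integral O(1 / (1 + |v| + I^(1/4))). Finally Cauchy-Schwarz bounds the L^1 norm by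
   the weighted L^2 norm, since (1 + |v| + sqrt I)^(-8) is integrable. *)
Require Import Defs.
From mathcomp Require Import all_boot all_order all_algebra.
From mathcomp Require Import all_classical all_reals all_analysis.
From mathcomp Require Import measurable_realfun ess_sup_inf ring lra.

Set Implicit Arguments.
Unset Strict Implicit.
Unset Printing Implicit Defensive.

Import Order.TTheory GRing.Theory Num.Def Num.Theory.
Import numFieldNormedType.Exports.

Local Open Scope classical_set_scope.
Local Open Scope ring_scope.

(** The weighted bound on f holds only almost everywhere, whereas the gain term evaluates f along
    the collision map, and its integrand is not shown to be measurable. Both obstacles are met by
    comparison with a measurable [g] that equals L |f| off a null set and +oo on it: the comparison
    holds at every collision, all substitutions act on [g], and the integral of [g] is still L times
    the L^1 norm of f(t, x, .).

    No differential change of variables occurs. Surface measure is defined by cones, so polar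
    coordinates reduce to dilations, Tonelli's theorem and affine substitutions in one variable;
    domains may be enlarged, since only upper bounds are sought.

    The kernel is too singular for vs alone: for small I and Is it behaves like |vs - v|^(-3 -
    alpha), which is not integrable in dimension 3. Integration in Is helps: as Is scales like |vs -
    v|^2, the condition becomes 3 + alpha < 5. Negative powers are replaced by dyadic step series,
    whose integrals are geometric series. *)

Section integral_upper_bounds.
Context d (T : measurableType d) (R : realType).
Variable mu : {measure set T -> \bar R}.
Local Open Scope ereal_scope.

(* Unlike [ge0_le_integral], neither function has to be measurable: the integral
   of a nonnegative function is a supremum over the simple functions below it. *)
Lemma ge0_le_integralT (f g : T -> \bar R) :
  (forall x, 0 <= f x) -> (forall x, f x <= g x) ->
  \int[mu]_x f x <= \int[mu]_x g x.
Proof.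
move=> f0 fg.
have g0 x : 0 <= g x by exact: le_trans (f0 x) (fg x).
rewrite !ge0_integralTE//; apply: le_ereal_sup => _ [h hf <-].
by exists h => // x; exact: le_trans (hf x) (fg x).
Qed.

(** The positive and the negative part of h are both at most H, and |p - n| <= max(p, n) for p, n >=
    0; an infinite p or n forces the integral of H to be infinite. Since [h] is arbitrary, this
    applies to the gain integrand as it stands. *)
Lemma abse_integral_le (D : set T) (h H : T -> \bar R) :
  (forall x, 0 <= H x) -> (forall x, D x -> `|h x| <= H x) ->
  `|\int[mu]_(x in D) h x| <= \int[mu]_x H x.
Proof.
move=> H0 hH; rewrite integral_mkcond integralE.
have absH x : `|(h \_ D) x| <= H x.
  rewrite /patch; case: ifPn => [|_]; first by rewrite inE => /hH.
  by rewrite abse0.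
have posH : \int[mu]_x (h \_ D)^\+ x <= \int[mu]_x H x.
  apply: ge0_le_integralT => [x|x]; first exact: funepos_ge0.
  apply: le_trans (absH x); rewrite -/((abse \o (h \_ D)) x) fune_abse.
  by rewrite leeDl// funeneg_ge0.
have negH : \int[mu]_x (h \_ D)^\- x <= \int[mu]_x H x.
  apply: ge0_le_integralT => [x|x]; first exact: funeneg_ge0.
  apply: le_trans (absH x); rewrite -/((abse \o (h \_ D)) x) fune_abse.
  by rewrite leeDr// funepos_ge0.
have p0 : 0 <= \int[mu]_x (h \_ D)^\+ x by apply: integral_ge0 => x _; exact: funepos_ge0.
have n0 : 0 <= \int[mu]_x (h \_ D)^\- x by apply: integral_ge0 => x _; exact: funeneg_ge0.
move: p0 n0 posH negH.
move: (\int[mu]_x (h \_ D)^\+ x) (\int[mu]_x (h \_ D)^\- x) (\int[mu]_x H x).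
move=> [p||] [n||] [c||]//=; rewrite ?leey ?lee_fin// => p0 n0 pc nc.
by rewrite ler_norml; apply/andP; split; lra.
Qed.

End integral_upper_bounds.

(** * Tonelli's theorem and affine substitutions *)

Section sigma_prod_tonelli.
Context d1 d2 (T1 : measurableType d1) (T2 : measurableType d2) (R : realType).
Variables (m1 : {sigma_finite_measure set T1 -> \bar R})
          (m2 : {sigma_finite_measure set T2 -> \bar R}).
Variable f : T1 * T2 -> \bar R.
Hypothesis mf : measurable_fun setT f.
Hypothesis f0 : forall x, (0 <= f x)%E.
Local Open Scope ereal_scope.

Lemma sigma_prod_tonelli1 :
  \int[m1 \xs m2]_z f z = \int[m1]_x \int[m2]_y f (x, y).
Proof. exact: fubini_tonelli1. Qed.

Lemma sigma_prod_tonelli2 :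
  \int[m1 \xs m2]_z f z = \int[m2]_y \int[m1]_x f (x, y).
Proof. exact: fubini_tonelli2. Qed.

End sigma_prod_tonelli.

Section affine_substitution.
Context {R : realType}.
Local Notation mR := (measurableTypeR R).
Local Notation leb := (@lebesgue_measure R).

(** The scaled pushforward is a measure, so uniqueness of Lebesgue measure leaves only the intervals
    []x, y]]. For a < 0 the preimage is closed on the left instead of the right, which does not
    change its length. *)
Lemma lebesgue_measure_affine (a b : R) (A : set mR) : a != 0 -> measurable A ->
  (`|a|%:E * leb ((fun x => a * x + b)%R @^-1` A))%E = leb A.
Proof.
move=> a0 mA.
pose phi (x : mR) : mR := a * x + b.
have mphi : measurable_fun [set: mR] phi by apply: measurable_funD => //; exact: measurable_funM.
pose pushfwd : {measure set mR -> \bar R} := pushforward leb phi.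
pose k : {nonneg R} := NngNum (normr_ge0 a).
pose mu : {measure set mR -> \bar R} := mscale k (pushfwd mphi).
suff : forall X, measurable X -> leb X = mu X by move=> /(_ A mA) ->.
apply: lebesgue_measure_unique => X /ocitvP[->|[[x y] /= xy ->]].
  by rewrite !measure0.
change (leb `]x, y] = `|a|%:E * leb (phi @^-1` `]x, y]))%E.
have [an|ap] := ltP a 0.
  have -> : phi @^-1` `]x, y] = `[(y - b) / a, (x - b) / a[%classic.
    apply/seteqP; split => z; rewrite /phi /= !in_itv /=.
      by rewrite ler_ndivrMr// ltr_ndivlMr// => /andP[? ?]; apply/andP; split; nra.
    by rewrite ler_ndivrMr// ltr_ndivlMr// => /andP[? ?]; apply/andP; split; nra.
  rewrite !lebesgue_measure_itv /= !lte_fin xy ltr_nM2r ?invr_lt0// ltrD2r xy.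
  by rewrite ltr0_norm// -!EFinB -EFinM; congr EFin; field.
have {}ap : 0 < a by rewrite lt_neqAle eq_sym a0.
have -> : phi @^-1` `]x, y] = `](x - b) / a, (y - b) / a]%classic.
  apply/seteqP; split => z; rewrite /phi /= !in_itv /=.
    by rewrite ler_pdivlMr// ltr_pdivrMr// => /andP[? ?]; apply/andP; split; nra.
  by rewrite ler_pdivlMr// ltr_pdivrMr// => /andP[? ?]; apply/andP; split; nra.
rewrite !lebesgue_measure_itv /= !lte_fin xy ltr_pM2r ?invr_gt0// ltrD2r xy.
by rewrite gtr0_norm// -!EFinB -EFinM; congr EFin; field.
Qed.

Lemma ge0_integral_affine (a b : R) (g : mR -> \bar R) : a != 0 ->
  measurable_fun setT g -> (forall x, 0 <= g x)%E ->
  (\int[leb]_x g (a * x + b)%R = `|a|^-1%:E * \int[leb]_x g x)%E.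
Proof.
move=> a0 mg g0.
pose phi (x : mR) : mR := a * x + b.
have mphi : measurable_fun [set: mR] phi by apply: measurable_funD => //; exact: measurable_funM.
pose pushfwd : {measure set mR -> \bar R} := pushforward leb phi.
pose k : {nonneg R} := NngNum (normr_ge0 a).
pose mu : {measure set mR -> \bar R} := mscale k (pushfwd mphi).
have -> : (\int[leb]_x g x = \int[mu]_x g x)%E.
  apply: eq_measure_integral => A mA _; rewrite /mu /mscale /pushfwd /pushforward /=.
  by rewrite -(lebesgue_measure_affine b a0 mA).
rewrite ge0_integral_mscale// muleA -EFinM mulVf ?normr_eq0// mul1e.
by rewrite (ge0_integral_pushforward mphi).
Qed.

Lemma leb3_integral (g : mR * mR * mR -> \bar R) :
  measurable_fun setT g -> (forall x, 0 <= g x)%E ->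
  (\int[@leb3 R]_v g v =
   \int[leb]_x \int[leb]_y \int[leb]_z g (x, y, z))%E.
Proof.
move=> mg g0; rewrite /leb3 sigma_prod_tonelli1//.
rewrite (sigma_prod_tonelli1 _ _ (f := fun p => \int[leb]_z g (p, z))%E)//.
  exact: (measurable_fun_fubini_tonelli_F (m2 := leb) g mg).
by move=> p; exact: integral_ge0.
Qed.

(** One coordinate at a time, the innermost first; each one-dimensional substitution contributes a
    factor |c|^(-1). *)
Lemma ge0_integral_affine3 (c : R) (m : R * R * R) (g : mR * mR * mR -> \bar R) :
  c != 0 -> measurable_fun setT g -> (forall x, 0 <= g x)%E ->
  (\int[@leb3 R]_v g (m + scale3 c v)%R = (`|c| ^- 3)%:E * \int[@leb3 R]_v g v)%E.
Proof.
move=> c0 mg g0.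
have ms : measurable_fun setT (fun v : mR * mR * mR => (m + scale3 c v : mR * mR * mR)).
  apply/measurable_fun_pairP; split; first apply/measurable_fun_pairP; first split.
  - by apply: measurable_funD => //; apply: measurable_funM => //; exact: measurableT_comp.
  - by apply: measurable_funD => //; apply: measurable_funM => //; exact: measurableT_comp.
  - by apply: measurable_funD => //; apply: measurable_funM => //; exact: measurableT_comp.
rewrite leb3_integral => [|//|//]; last exact: (measurableT_comp mg ms).
rewrite leb3_integral//.
have mF : measurable_fun setT (fun p : mR * mR => \int[leb]_z g (p, z))%E.
  exact: (measurable_fun_fubini_tonelli_F (m2 := leb) g mg).
have F0 (p : mR * mR) : (0 <= \int[leb]_z g (p, z))%E by exact: integral_ge0.
have mG : measurable_fun setT (fun x : mR => \int[leb]_y \int[leb]_z g (x, y, z))%E.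
  exact: (measurable_fun_fubini_tonelli_F (m2 := leb) _ mF).
case: m ms => [[m1 m2] m3] ms /=.
transitivity (\int[leb]_x \int[leb]_y (`|c|^-1%:E * \int[leb]_z g ((c * x + m1)%R, (c * y + m2)%R, z)))%E.
  apply: eq_integral => x _; apply: eq_integral => y _.
  rewrite -(ge0_integral_affine m3 (g := fun z => g (c * x + m1, c * y + m2, z))) => [|//||//].
    by apply: eq_integral => z _; congr g; rewrite /scale3/=; congr (_, _, _);
       rewrite addrC.
  exact: (measurableT_comp mg (measurable_fun_pair _ _)).
transitivity (\int[leb]_x (`|c|^-1%:E * (`|c|^-1%:E * \int[leb]_y \int[leb]_z g ((c * x + m1)%R, y, z))))%E.
  apply: eq_integral => x _; rewrite ge0_integralZl//.
  - rewrite (ge0_integral_affine m2 (g := fun y => \int[leb]_z g ((c * x + m1)%R, y, z))%E) => [//|//||//].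
    exact: (measurableT_comp mF (measurable_fun_pair _ _)).
  - apply: (measurableT_comp mF (measurable_fun_pair _ _)) => //.
    by apply: measurable_funD => //; exact: measurable_funM.
have mG' : measurable_fun setT (fun x : mR => \int[leb]_y \int[leb]_z g ((c * x + m1)%R, y, z))%E.
  by apply: (measurableT_comp mG); apply: measurable_funD => //; exact: measurable_funM.
have G0 x : (0 <= \int[leb]_y \int[leb]_z g (x, y, z))%E by exact: integral_ge0.
rewrite ge0_integralZl//; last 2 first.
- exact: emeasurable_funM.
- by move=> x _; rewrite mule_ge0.
rewrite ge0_integralZl// (ge0_integral_affine m1 (g := fun x => \int[leb]_y \int[leb]_z g (x, y, z))%E)//.
rewrite !muleA -!EFinM; congr (_%:E * _)%E.
by rewrite -!invfM !exprS expr0 mulr1 mulrA.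
Qed.

End affine_substitution.

(** * Integrable majorants of negative powers, at 0 and at infinity *)

Section dyadic_majorants.
Context {R : realType}.
Local Notation mR := (measurableTypeR R).
Local Notation leb := (@lebesgue_measure R).

(* With d < 1 this majorizes a negative power of |x| near 0, and is +oo at 0;
   with d > 1 it majorizes a negative power at infinity. Either way its integral
   is a geometric series of ratio c * d. *)
Definition dyadic (c d x : R) : \bar R :=
  (\sum_(n <oo) (c ^+ n * (`|x| <= d ^+ n)%R%:R)%:E)%E.

Lemma dyadic_term_ge0 (c d x : R) n : 0 <= c ->
  (0 <= (c ^+ n * (`|x| <= d ^+ n)%R%:R)%:E)%E.
Proof. by move=> c0; rewrite lee_fin mulr_ge0// exprn_ge0. Qed.

Lemma dyadic_ge0 (c d x : R) : 0 <= c -> (0 <= dyadic c d x)%E.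
Proof. by move=> c0; apply: nneseries_ge0 => n _ _; exact: dyadic_term_ge0. Qed.

Lemma measurable_dyadic_term (c d : R) n : measurable_fun [set: mR]
  (fun x : mR => (c ^+ n * (`|x| <= d ^+ n)%R%:R)%:E).
Proof.
apply/measurable_EFinP; apply: measurable_funM => //.
rewrite (_ : (fun x => _) = \1_([set x : mR | `|x| <= d ^+ n])); last first.
  by apply/funext => x; rewrite indicE mem_setE.
apply: measurable_indic.
rewrite (_ : [set _ | _] = `[- d ^+ n, d ^+ n]%classic); last first.
  by apply/seteqP; split => x /=; rewrite in_itv/= ler_norml.
exact: measurable_itv.
Qed.

Lemma measurable_dyadic (c d : R) : 0 <= c -> measurable_fun [set: mR] (dyadic c d).
Proof.
move=> c0; apply: ge0_emeasurable_sum => [n x _ _|n _].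
  exact: dyadic_term_ge0.
exact: measurable_dyadic_term.
Qed.

Lemma integral_dyadic (c d : R) : 0 <= c -> 0 < d -> c * d < 1 ->
  (\int[leb]_x dyadic c d x = (2 * (1 - c * d)^-1)%:E)%E.
Proof.
move=> c0 d0 cd1.
rewrite integral_nneseries//; last 2 first.
- by move=> n; exact: measurable_dyadic_term.
- by move=> n x _; exact: dyadic_term_ge0.
transitivity (\sum_(n <oo) (2 * (c * d) ^+ n)%:E)%E.
  apply: eq_eseriesr => n _.
  have cn0 : 0 <= c ^+ n by rewrite exprn_ge0.
  have dn0 : 0 < d ^+ n by rewrite exprn_gt0.
  transitivity (\int[leb]_x ((c ^+ n)%:E * (\1_(`[- d ^+ n, d ^+ n]%classic : set mR) x)%:E))%E.
    by apply: eq_integral => x _; rewrite EFinM indicE mem_setE /= in_itv/= ler_norml.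
  have mI : measurable (`[- d ^+ n, d ^+ n]%classic : set mR) by exact: measurable_itv.
  rewrite ge0_integralZl//; last exact/measurable_EFinP/measurable_indic.
  rewrite integral_indic//.
  rewrite setIT /= lebesgue_measure_itv/= lte_fin ifT; last lra.
  by rewrite -EFinB -EFinM exprMn; congr EFin; ring.
have cd0 : 0 <= c * d by rewrite mulr_ge0// ltW.
apply/cvg_lim => //.
have -> : (fun n => \sum_(0 <= i < n) (2 * (c * d) ^+ i)%:E)%E =
    EFin \o series (geometric 2 (c * d)).
  by apply/funext => n; rewrite /series/= -sumEFin.
apply: cvg_EFin; first by near=> n.
apply: cvg_geometric_series.
by rewrite ger0_norm.
Unshelve. all: by end_near. Qed.

Lemma dyadic_ge (c d x : R) n : 0 <= c -> `|x| <= d ^+ n -> ((c ^+ n)%:E <= dyadic c d x)%E.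
Proof.
move=> c0 xd.
rewrite /dyadic (@nneseries_split _ _ 0 n.+1); last by move=> k _; exact: dyadic_term_ge0.
rewrite big_nat_recr//= xd mulr1.
rewrite -[X in (X <= _)%E]adde0 leeD//.
  rewrite -[X in (X <= _)%E]add0e leeD//.
  by apply: sume_ge0 => k _; exact: dyadic_term_ge0.
by apply: nneseries_ge0 => k _ _; exact: dyadic_term_ge0.
Qed.

Lemma dyadic_scale (x : R) : 1 <= x -> exists n, 2 ^+ n <= x < 2 ^+ n.+1.
Proof.
move=> x1.
have ex : exists n, x < 2 ^+ n.
  exists (Num.truncn x).+1; rewrite (lt_le_trans (truncnS_gt x))//.
  rewrite -natrX ler_nat; exact: ltnW (ltn_expl _ _).
case: (ex_minnP ex) => [[|n]] xn minn.
  by move: xn; rewrite expr0 ltNge x1.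
exists n; rewrite xn andbT leNgt; apply/negP => /minn.
by rewrite ltnn.
Qed.

(** The exponent has to exceed 1 for integrability on the line, and must not exceed 8/5, because a
    product of four such factors is to majorize the power -8 of 1 + |v| + sqrt I, where I counts
    twice. *)
Definition decay (x : R) : R := (1 + `|x|) `^ (- (3 / 2)).

(** Stands for 1 + |x|^(-s) near 0, up to constants. The summand 1 allows a factor to be inserted
    where its variable is not singular. *)
Definition sing (s x : R) : \bar R := (1 + dyadic (2 `^ s) 2^-1 x)%E.

Lemma decay_ge0 x : 0 <= decay x. Proof. exact: powR_ge0. Qed.

Lemma decay_le1 x : decay x <= 1.
Proof.
rewrite /decay -[leRHS](powRr0 (1 + `|x|)) ler_powR ?lerDl//; lra.
Qed.

Lemma measurable_decay : measurable_fun [set: mR] decay.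
Proof.
apply: (measurableT_comp (measurable_powR _)); exact: measurable_funD.
Qed.

(** For 2^n <= 1 + |x| < 2^(n + 1) the term of index n + 1 alone suffices; the factor 2^(3/2) makes
    up for the step from n to n + 1. *)
Lemma decay_le_dyadic x :
  ((decay x)%:E <= (2 `^ (3 / 2))%:E * dyadic (2 `^ (- (3 / 2))) 2 x)%E.
Proof.
have [|n /andP[nx xn]] := @dyadic_scale (1 + `|x|); first by rewrite lerDl.
have : (((2 `^ (- (3 / 2))) ^+ n.+1)%:E <= dyadic (2 `^ (- (3 / 2))) 2 x)%E.
  by apply: dyadic_ge; [exact: powR_ge0|lra].
move=> dyn; apply: (@le_trans _ _ ((2 `^ (3 / 2)) * ((2 `^ (- (3 / 2))) ^+ n.+1))%:E).
  rewrite lee_fin exprS mulrA -powRD ?pnatr_eq0 ?implybT// subrr powRr0 mul1r.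
  rewrite -powR_mulrn ?powR_ge0// -powRrM mulrC powRrM /decay !powRN.
  rewrite lef_pV2 ?posrE ?powR_gt0 ?ltr_pwDl//.
  by rewrite ge0_ler_powR ?nnegrE ?powR_ge0 ?addr_ge0 ?powR_mulrn//; lra.
rewrite EFinM; apply: lee_wpmul2l => //; rewrite lee_fin; exact: powR_ge0.
Qed.

Lemma integral_decay_fin : exists K : R, (\int[leb]_x (decay x)%:E <= K%:E)%E.
Proof.
set c : R := 2 `^ (- (3 / 2)).
have c0 : 0 <= c by exact: powR_ge0.
have c2 : c * 2 < 1.
  rewrite /c -[X in _ * X](@powRr1 R 2)// -powRD ?pnatr_eq0 ?implybT//.
  rewrite -[ltRHS](powRr0 2) -[_ < _]/(_ < _).
  rewrite (_ : - (3 / 2) + 1 = - (2^-1)) ?powRN; last lra.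
  by rewrite powRr0 invf_lt1 ?powR_gt0// powR12_sqrt// -[ltLHS]sqrtr1 ltr_sqrt ?ltr1n.
exists (2 `^ (3 / 2) * (2 * (1 - c * 2)^-1)).
rewrite EFinM -(integral_dyadic c0 _ c2)// -ge0_integralZl//; last 2 first.
- exact: measurable_dyadic.
- by move=> x _; exact: dyadic_ge0.
apply: ge0_le_integralT => x; first by rewrite lee_fin decay_ge0.
exact: decay_le_dyadic.
Qed.

Lemma sing_ge1 s x : (1 <= sing s x)%E.
Proof. by rewrite /sing leeDl// dyadic_ge0// powR_ge0. Qed.

Lemma sing_ge0 s x : (0 <= sing s x)%E.
Proof. exact: le_trans (sing_ge1 s x). Qed.

Lemma measurable_sing s : measurable_fun [set: mR] (sing s).
Proof. by apply: emeasurable_funD => //; apply: measurable_dyadic; exact: powR_ge0. Qed.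

(** Stated with a bound [rho] of |x| in place of |x| because a single quantity, the energy, bounds
    several variables at once; this also covers x = 0. The term of index n with 2^n <= 1 / rho <
    2^(n + 1) gives the bound. *)
Lemma sing_ge (s x rho : R) : 0 <= s -> 0 < rho <= 1 -> `|x| <= rho ->
  ((rho `^ (- s))%:E <= (2 `^ s)%:E * sing s x)%E.
Proof.
move=> s0 /andP[rho0 rho1] xrho.
have [|n /andP[nr rn]] := @dyadic_scale rho^-1; first by rewrite invf_ge1.
have xn : `|x| <= 2^-1 ^+ n.
  by rewrite (le_trans xrho)// exprVn -[leLHS]invrK lef_pV2 ?posrE ?invr_gt0 ?exprn_gt0.
have /le_trans -> // : ((rho `^ (- s))%:E <= (2 `^ s)%:E * ((2 `^ s) ^+ n)%:E)%E.
  rewrite -EFinM lee_fin -exprS -powR_mulrn ?powR_ge0// powRAC powR_mulrn//.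
  rewrite powRN -powR_inv1 ?powR_ge0// powRAC powR_inv1 ?(ltW rho0)//.
  by rewrite ge0_ler_powR ?nnegrE ?exprn_ge0 ?invr_ge0 ?(ltW rho0) ?(ltW rn).
apply: lee_wpmul2l; first by rewrite lee_fin powR_ge0.
by rewrite (le_trans (dyadic_ge _ xn)) ?powR_ge0// /sing leeDr.
Qed.

(** The bound is uniform in x: against the summand 1 of [sing] the factor [decay] is integrated,
    while against the dyadic part it is bounded by 1 and translation invariance removes x. The
    dyadic part has a geometric series of ratio 2^(s - 1), whence s < 1. *)
Lemma decay_sing_integral s : s < 1 -> exists2 K : R, 0 < K &
  forall x, (\int[leb]_y ((decay y)%:E * sing s (y - x)%R) <= K%:E)%E.
Proof.
move=> s1.
have c0 : 0 <= 2 `^ s :> R by exact: powR_ge0.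
have c2 : 2 `^ s * 2^-1 < 1 :> R.
  rewrite ltr_pdivrMr// mul1r -[ltRHS](@powRr1 R 2)//.
  by rewrite /powR pnatr_eq0/= ltr_expR ltr_pM2r// ln_gt0// ltr1n.
have [K1 K1P] := integral_decay_fin.
set K2 : R := 2 * (1 - 2 `^ s * 2^-1)^-1.
exists (`|K1| + `|K2| + 1) => [|x]; first by rewrite ltr_wpDl// addr_ge0.
have msh : measurable_fun [set: mR] (fun y : mR => dyadic (2 `^ s) 2^-1 (y - x)).
  by apply: (measurableT_comp (measurable_dyadic _ c0)); exact: measurable_funB.
have d0 y : (0 <= dyadic (2 `^ s) 2^-1 y)%E by exact: dyadic_ge0.
apply: (@le_trans _ _ (\int[leb]_y ((decay y)%:E + dyadic (2 `^ s) 2^-1 (y - x)%R))%E).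
  apply: ge0_le_integralT => y.
    by rewrite mule_ge0 ?sing_ge0// lee_fin decay_ge0.
  rewrite /sing ge0_muleDr// mule1 leeD2l// -[leRHS]mul1e.
  by apply: lee_wpmul2r => //; rewrite lee_fin decay_le1.
rewrite ge0_integralD//; last 2 first.
- by move=> y _; rewrite lee_fin decay_ge0.
- by apply/measurable_EFinP; exact: measurable_decay.
have -> : (\int[leb]_y dyadic (2 `^ s) 2^-1 (y - x)%R = K2%:E)%E.
  rewrite -integral_dyadic//.
  transitivity (\int[leb]_y dyadic (2 `^ s) 2^-1 (1 * y - x)%R)%E.
    by apply: eq_integral => y _; rewrite mul1r.
  by rewrite (ge0_integral_affine (- x) (oner_neq0 R) (measurable_dyadic _ c0) d0) normr1 invr1 mul1e.
apply: (@le_trans _ _ (K1%:E + K2%:E)%E); first exact: leeD.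
by rewrite -EFinD lee_fin -[leLHS]addr0 lerD// lerD// ler_norm.
Qed.

End dyadic_majorants.

(** * Measurability tools and the Euclidean norm *)

Section measurability.
Context d (T : measurableType d) (R : realType).
Local Notation mR := (measurableTypeR R).

Lemma measurable_bool_natr (b : T -> bool) : measurable_fun setT b ->
  measurable_fun setT (fun x => (b x)%:R : mR).
Proof.
move=> mb; rewrite (_ : (fun x => _) = (fun x => if b x then 1 else 0)).
  exact: measurable_fun_ifT.
by apply/funext => x; case: (b x).
Qed.

Lemma measurable_scale_shift3 (u w : T -> mR * mR * mR) (s : T -> mR) :
  measurable_fun setT u -> measurable_fun setT w -> measurable_fun setT s ->
  measurable_fun setT (fun x => u x + scale3 (s x) (w x) : mR * mR * mR).
Proof.
move=> mu mw ms.
have m1 (v : T -> mR * mR * mR) : measurable_fun setT v ->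
  [/\ measurable_fun setT (fun x => (v x).1.1 : mR),
      measurable_fun setT (fun x => (v x).1.2 : mR) &
      measurable_fun setT (fun x => (v x).2 : mR)].
  move=> mv; split.
  - exact: (measurableT_comp measurable_fst (measurableT_comp measurable_fst mv)).
  - exact: (measurableT_comp measurable_snd (measurableT_comp measurable_fst mv)).
  - exact: (measurableT_comp measurable_snd mv).
have [u1 u2 u3] := m1 _ mu; have [w1 w2 w3] := m1 _ mw.
apply/measurable_fun_pairP; split; first apply/measurable_fun_pairP; first split.
- by apply: measurable_funD => //; exact: measurable_funM.
- by apply: measurable_funD => //; exact: measurable_funM.
- by apply: measurable_funD => //; exact: measurable_funM.
Qed.

Lemma measurable_sqrtr (s : T -> mR) : measurable_fun setT s ->
  measurable_fun setT (fun x => Num.sqrt (s x) : mR).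
Proof.
move=> ms; apply: (measurableT_comp _ ms).
by apply: continuous_measurable_fun; exact: sqrt_continuous.
Qed.

Lemma measurable_powRr (s : T -> mR) p : measurable_fun setT s ->
  measurable_fun setT (fun x => s x `^ p : mR).
Proof. by move=> ms; exact: (measurableT_comp (measurable_powR p) ms). Qed.

End measurability.

Section vectors.
Context {R : realType}.
Implicit Types u v : R * R * R.

Lemma norm3_ge0 v : 0 <= norm3 v. Proof. exact: sqrtr_ge0. Qed.

Lemma sqr_norm3 v : norm3 v ^+ 2 = v.1.1 ^+ 2 + v.1.2 ^+ 2 + v.2 ^+ 2.
Proof. by rewrite sqr_sqrtr// !addr_ge0// sqr_ge0. Qed.

Lemma norm3_0 : norm3 (0 : R * R * R) = 0.
Proof. by rewrite /norm3 /= !expr0n !addr0 sqrtr0. Qed.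

Lemma norm3_scale3 a v : norm3 (scale3 a v) = `|a| * norm3 v.
Proof.
rewrite /norm3 /scale3 /= -sqrtr_sqr -sqrtrM ?sqr_ge0//; congr (Num.sqrt _); ring.
Qed.

Lemma scale3A a b v : scale3 a (scale3 b v) = scale3 (a * b) v.
Proof. by rewrite /scale3 /= !mulrA. Qed.

Lemma norm3_normalize v : 0 < norm3 v -> norm3 (scale3 (norm3 v)^-1 v) = 1.
Proof. by move=> v0; rewrite norm3_scale3 ger0_norm ?invr_ge0 ?norm3_ge0// mulVf// gt_eqF. Qed.

End vectors.

(** * Integration over the sphere and polar coordinates *)

Section spherical_coordinates.
Context {R : realType}.
Local Notation mR := (measurableTypeR R).
Local Notation leb := (@lebesgue_measure R).
Local Notation normalize y := (scale3 (norm3 y)^-1 y).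

(** Away from the origin, the sphere measure is three times the pushforward of Lebesgue measure on
    the punctured unit ball under normalization. The map [phi] sends all other points to 0, so the
    two measures agree only off the origin; this is why h has to vanish there. *)
Lemma sphere_integral (h : mR * mR * mR -> \bar R) : measurable_fun setT h ->
  (forall w, 0 <= h w)%E -> (forall w, norm3 w = 0 -> h w = 0%E) ->
  (\int[@sphere_measure R]_w h w =
   3%:E * \int[@leb3 R]_y ((0 < norm3 y <= 1)%R%:R%:E * h (normalize y)))%E.
Proof.
move=> mh h0 h00.
pose phi (y : mR * mR * mR) : mR * mR * mR := if 0 < norm3 y <= 1 then normalize y else 0.
pose D : set (mR * mR * mR) := [set w | 0 < norm3 w].
have mball : measurable_fun [set: mR * mR * mR] (fun y => 0 < norm3 y <= 1 : bool).
  apply: measurable_and.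
    by apply: measurable_fun_ltr => //; exact: measurable_norm3.
  by apply: measurable_fun_ler => //; exact: measurable_norm3.
have mphi : measurable_fun setT phi.
  by apply: measurable_fun_ifT => //; exact: measurable_normalize3.
have mD : measurable D.
  have /(_ measurableT `]0, +oo[%classic (measurable_itv _)) := @measurable_norm3 R.
  rewrite setTI; congr (measurable _).
  by apply/seteqP; split => w; rewrite /D /= in_itv/= andbT.
pose pushfwd : {measure set (mR * mR * mR) -> \bar R} := pushforward (@leb3 R) phi.
pose k : {nonneg R} := NngNum (ler0n R 3).
pose mu : {measure set (mR * mR * mR) -> \bar R} := mscale k (pushfwd mphi).
have phiE (A : set (mR * mR * mR)) : A `<=` D -> phi @^-1` A = unit_cone A.
  move=> AD; apply/seteqP; split => y; rewrite /phi /unit_cone /=.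
    by case: ifPn => // _ /AD; rewrite /D /= norm3_0 ltxx.
  by move=> [-> Ay].
transitivity (\int[@sphere_measure R]_(w in D) h w)%E.
  rewrite [RHS]integral_mkcond; apply: eq_integral => w _; rewrite patchE.
  case: ifPn => //; rewrite notin_setE /D /= => /negP.
  by rewrite -leNgt => wle0; apply/h00/eqP; rewrite eq_le wle0 norm3_ge0.
transitivity (\int[mu]_(w in D) h w)%E.
  apply: eq_measure_integral => A mA AD.
  by change (sphere_measure A = 3%:E * leb3 (phi @^-1` A))%E; rewrite phiE.
have mhD : measurable_fun D h by exact: measurable_funS mh.
transitivity (3%:E * \int[pushfwd mphi]_(w in D) h w)%E.
  by rewrite /mu (@ge0_integral_mscale _ _ _ (pushfwd mphi) D mD k h mhD).
suff -> : (\int[pushfwd mphi]_(w in D) h w =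
  \int[@leb3 R]_y ((0 < norm3 y <= 1)%R%:R%:E * h (normalize y)))%E by [].
rewrite /pushfwd (ge0_integral_pushforward mphi _ mD mhD)//.
rewrite integral_mkcond; apply: eq_integral => y _; rewrite patchE.
case: ifPn => [|/negP]; rewrite inE /D /phi /=.
  by case: ifPn => [_ _|_]; rewrite ?norm3_0 ?ltxx// mul1e.
case: ifPn => [/andP[y0 y1]|_ _]; last by rewrite mul0e.
by rewrite norm3_normalize// ltr01.
Qed.

(* Polar coordinates around m with radius |c| sqrt q. The sphere measure is that of
   cones, so w becomes y / |y| with y in the unit ball; the substitutions
   y -> y / sqrt q and then q = |y|^2 u turn the integrand into G (m + c sqrt u y)
   with weight 1 / u, u >= 1, and a dilation in y leaves u^(-5/2), which is
   integrable. *)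
Lemma polar_integral_le : exists2 K : R, 0 < K &
  forall (c : R) (m : R * R * R) (G : mR * mR * mR -> \bar R), c != 0 ->
  measurable_fun setT G -> (forall x, 0 <= G x)%E ->
  (\int[leb]_q \int[@sphere_measure R]_w
     ((Num.sqrt q * (0 < q <= 1)%R%:R * (0 < norm3 w)%R%:R)%:E *
      G (m + scale3 (c * Num.sqrt q) w)%R)
   <= (K / `|c| ^+ 3)%:E * \int[@leb3 R]_y G y)%E.
Proof.
have [K KP] := @integral_decay_fin R.
exists (3 * (2 `^ (3 / 2) * (`|K| + 1))).
  by rewrite !mulr_gt0 ?powR_gt0// ltr_wpDl.
move=> c m G c0 mG G0.
(* [P2] is the integrand after y -> y / sqrt q: the factor q^(-3/2) of this dilation and
   [Num.sqrt q] combine to q^(-1). [P3] is the integrand after q = |y|^2 u, where dq / q = du /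
   u. *)
pose P2 (q : mR) (y : mR * mR * mR) : \bar R :=
  ((q `^ (-1) * (0 < q <= 1)%R%:R * (0 < norm3 y <= Num.sqrt q)%R%:R)%:E *
   G (m + scale3 (c * Num.sqrt q) (normalize y))%R)%E.
pose P3 (u : mR) (y : mR * mR * mR) : \bar R :=
  ((u `^ (-1) * (1 <= u)%R%:R)%:E * G (m + scale3 (c * Num.sqrt u) y)%R)%E.
have P20 q y : (0 <= P2 q y)%E by rewrite mule_ge0// lee_fin !mulr_ge0// powR_ge0.
have P30 q y : (0 <= P3 q y)%E by rewrite mule_ge0// lee_fin !mulr_ge0// powR_ge0.
have mP2 : measurable_fun setT (fun z : mR * (mR * mR * mR) => P2 z.1 z.2).
  apply: emeasurable_funM.
    apply/measurable_EFinP; apply: measurable_funM; first apply: measurable_funM.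
    - by apply: measurable_powRr; exact: measurable_fst.
    - apply: measurable_bool_natr; apply: measurable_and.
        exact: measurable_fun_ltr.
      exact: measurable_fun_ler.
    - apply: measurable_bool_natr; apply: measurable_and.
        apply: measurable_fun_ltr => //.
        exact: (measurableT_comp (@measurable_norm3 R)).
      apply: measurable_fun_ler; first exact: (measurableT_comp (@measurable_norm3 R)).
      exact: measurable_sqrtr.
  apply: (measurableT_comp mG); apply: measurable_scale_shift3 => //.
    exact: (measurableT_comp (@measurable_normalize3 R)).
  by apply: measurable_funM => //; exact: measurable_sqrtr.
have mP3 : measurable_fun setT (fun z : (mR * mR * mR) * mR => P3 z.2 z.1).
  apply: emeasurable_funM.
    apply/measurable_EFinP; apply: measurable_funM.
    - by apply: measurable_powRr; exact: measurable_snd.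
    - by apply: measurable_bool_natr; exact: measurable_fun_ler.
  apply: (measurableT_comp mG); apply: measurable_scale_shift3 => //.
  by apply: measurable_funM => //; exact: measurable_sqrtr.
have step1 q : (\int[@sphere_measure R]_w
     ((Num.sqrt q * (0 < q <= 1)%R%:R * (0 < norm3 w)%R%:R)%:E *
      G (m + scale3 (c * Num.sqrt q) w)%R) = 3%:E * \int[@leb3 R]_y P2 q y)%E.
  rewrite sphere_integral; last 3 first.
  - apply: emeasurable_funM.
      apply/measurable_EFinP; apply: measurable_funM => //.
      apply: measurable_bool_natr; apply: measurable_fun_ltr => //.
      exact: measurable_norm3.
    by apply: (measurableT_comp mG); exact: measurable_scale_shift3.
  - by move=> w; rewrite mule_ge0// lee_fin !mulr_ge0// sqrtr_ge0.
  - by move=> w ->; rewrite ltxx mulr0 mul0e.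
  congr (_ * _)%E.
  have [/andP[q0 q1]|qN] := boolP (0 < q <= 1); last first.
    by apply: eq_integral => y _; rewrite /P2 (negbTE qN) !(mulr0, mul0r, mul0e, mule0).
  pose F y := ((0 < norm3 y <= Num.sqrt q)%R%:R%:E * G (m + scale3 (c * Num.sqrt q) (normalize y))%R)%E.
  have sq0 : 0 < Num.sqrt q by rewrite sqrtr_gt0.
  have mF : measurable_fun setT F.
    apply: emeasurable_funM.
      apply/measurable_EFinP; apply: measurable_bool_natr; apply: measurable_and.
        by apply: measurable_fun_ltr => //; exact: measurable_norm3.
      by apply: measurable_fun_ler => //; exact: measurable_norm3.
    by apply: (measurableT_comp mG); apply: measurable_scale_shift3 => //; exact: measurable_normalize3.
  have F0 y : (0 <= F y)%E by rewrite mule_ge0// lee_fin.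
  have mF' : measurable_fun setT (fun y : mR * mR * mR => F (0 + scale3 (Num.sqrt q) y)).
    by apply: (measurableT_comp mF); exact: measurable_scale_shift3.
  have FE : (\int[@leb3 R]_y F y =
      (Num.sqrt q ^+ 3)%:E * \int[@leb3 R]_y F (0 + scale3 (Num.sqrt q) y)%R)%E.
    rewrite (ge0_integral_affine3 0 (lt0r_neq0 sq0) mF F0) muleA -EFinM.
    by rewrite gtr0_norm// mulfV ?mul1e// expf_neq0// gt_eqF.
  transitivity ((Num.sqrt q)%:E * \int[@leb3 R]_y F (0 + scale3 (Num.sqrt q) y)%R)%E; last first.
    transitivity ((q `^ (-1))%:E * \int[@leb3 R]_y F y)%E.
      rewrite FE muleA -EFinM; congr (_%:E * _)%E.
      rewrite powR_inv1 ?ltW// -[X in X^-1](sqr_sqrtr (ltW q0)).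
      by field; rewrite gt_eqF.
    rewrite -ge0_integralZl//; last by rewrite lee_fin powR_ge0.
    by apply: eq_integral => y _; rewrite /F /P2 q0 q1 mulr1 EFinM muleA.
  rewrite -ge0_integralZl//.
  apply: eq_integral => y _; rewrite /F mulr1 add0r.
  have nS : norm3 (scale3 (Num.sqrt q) y) = Num.sqrt q * norm3 y.
    by rewrite norm3_scale3 gtr0_norm.
  have leS : (Num.sqrt q * norm3 y <= Num.sqrt q) = (norm3 y <= 1).
    by rewrite -[X in _ <= X]mulr1 ler_pM2l.
  rewrite nS pmulr_rgt0// leS.
  have [/andP[y0 y1]|_] := boolP (0 < norm3 y <= 1); last by rewrite !(mul0e, mule0).
  rewrite norm3_normalize// ltr01 mulr1 !mul1e !scale3A.
  rewrite (_ : c * Num.sqrt q * _ * Num.sqrt q = c * Num.sqrt q / norm3 y)//.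
  by field; rewrite !gt_eqF.
(* The condition |y| <= sqrt q becomes u >= 1, and sqrt q / |y| becomes sqrt u. The condition q <= 1
   is dropped, whence only an inequality. *)
have step2 y : (\int[leb]_q P2 q y <= \int[leb]_u P3 u y)%E.
  have [y0|] := ltP 0 (norm3 y); last first.
    move=> yle0; rewrite (_ : (fun q => P2 q y) = cst 0%E) ?integral0 ?integral_ge0//.
    by apply/funext => q; rewrite /P2 (le_gtF yle0) mulr0 mul0e.
  pose a := norm3 y ^+ 2; have a0 : 0 < a by rewrite exprn_gt0.
  have mP2y : measurable_fun setT (fun q : mR => P2 q y).
    exact: (measurableT_comp mP2 (measurable_fun_pair _ _)).
  have := ge0_integral_affine 0 (lt0r_neq0 a0) mP2y (fun q => P20 q y).
  move=> /(congr1 (fun z => a%:E * z)%E).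
  rewrite muleA -EFinM (gtr0_norm a0) mulfV ?gt_eqF// mul1e => <-.
  rewrite -ge0_integralZl//; last 2 first.
  - apply: (measurableT_comp mP2y); apply: measurable_funD => //; exact: measurable_funM.
  - by rewrite lee_fin ltW.
  apply: ge0_le_integralT => u; first by rewrite mule_ge0// lee_fin ltW.
  rewrite /P2 addr0 y0 /=.
  have [/andP[au0 au1]|_] := boolP (0 < a * u <= 1); last first.
    by rewrite !(mulr0, mul0r, mul0e, mule0).
  have u0 : 0 < u by rewrite -(pmulr_rgt0 _ a0).
  have -> : Num.sqrt (a * u) = norm3 y * Num.sqrt u.
    by rewrite sqrtrM ?ltW// sqrtr_sqr ger0_norm// ltW.
  rewrite -[X in (X <= _)%R]mulr1 ler_pM2l// -[X in (X <= Num.sqrt u)%R]sqrtr1 ler_sqrt ?(ltW u0)//.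
  rewrite /P3; have [u1|_] := boolP (1 <= u); last by rewrite !(mulr0, mul0r, mul0e, mule0).
  rewrite !mulr1 muleA -EFinM !powR_inv1 ?(ltW au0) ?(ltW u0)//.
  rewrite (_ : a * (a * u)^-1 = u^-1); last by field; rewrite !gt_eqF.
  rewrite scale3A (_ : c * (norm3 y * Num.sqrt u) * (norm3 y)^-1 = c * Num.sqrt u)//.
  by field; rewrite gt_eqF.
(* For u >= 1 one has 1 + u <= 2 u, which turns the u^(-3/2) of the dilation into [decay u] at the
   cost of 2^(3/2); the remaining u^(-1) is at most 1. *)
have step3 u : (\int[@leb3 R]_y P3 u y <=
    (2 `^ (3 / 2) / `|c| ^+ 3)%:E * ((decay u)%:E * \int[@leb3 R]_y G y))%E.
  have IG0 : (0 <= \int[@leb3 R]_y G y)%E by exact: integral_ge0.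
  have [u1|uN] := boolP (1 <= u); last first.
    rewrite (_ : (fun y => P3 u y) = cst 0%E).
      by rewrite integral0 !mule_ge0// lee_fin ?decay_ge0// divr_ge0 ?powR_ge0// exprn_ge0.
    by apply/funext => y; rewrite /P3 (negbTE uN) mulr0 mul0e.
  have u0 : 0 < u by exact: lt_le_trans u1.
  have su0 : 0 < Num.sqrt u by rewrite sqrtr_gt0.
  rewrite ge0_integralZl//; last 2 first.
  - by apply: (measurableT_comp mG); exact: measurable_scale_shift3.
  - by rewrite lee_fin mulr_ge0// powR_ge0.
  have cu0 : c * Num.sqrt u != 0 by rewrite mulf_neq0// gt_eqF.
  rewrite (ge0_integral_affine3 m cu0 mG G0) u1 mulr1.
  rewrite !muleA -!EFinM; apply: lee_wpmul2r => //; rewrite lee_fin.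
  rewrite powR_inv1 ?(ltW u0)// normrM exprMn (ger0_norm (ltW su0)) invfM mulrCA mulrC -mulrA.
  have e1 : Num.sqrt u ^+ 3 = u `^ (3 / 2).
    rewrite -powR12_sqrt ?(ltW u0)// -powR_mulrn ?powR_ge0// -powRrM.
    by congr (_ `^ _); field.
  have e2 : (1 + u) `^ (3 / 2) <= 2 `^ (3 / 2) * u `^ (3 / 2).
    rewrite -powRM ?(ltW u0)// ge0_ler_powR ?nnegrE ?addr_ge0 ?mulr_ge0 ?(ltW u0)//; lra.
  rewrite mulrA [leRHS]mulrAC ler_pM2r ?invr_gt0 ?exprn_gt0 ?normr_gt0// e1.
  rewrite /decay (ger0_norm (ltW u0)) powRN ler_pdivlMr ?powR_gt0 ?addr_gt0//.
  have U0 : 0 < u `^ (3 / 2) by rewrite powR_gt0.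
  have iu : u^-1 <= 1 by rewrite invf_le1.
  rewrite mulrAC ler_pdivrMr//; apply: le_trans e2.
  by rewrite -[leRHS]mul1r ler_wpM2r// powR_ge0.
under eq_integral do rewrite step1.
rewrite ge0_integralZl//; last 2 first.
- exact: (measurable_fun_fubini_tonelli_F (m2 := @leb3 R) _ mP2).
- by move=> q _; exact: integral_ge0.
rewrite (fubini_tonelli (fun z => P2 z.1 z.2) mP2) => [|z]; last exact: P20.
apply: (@le_trans _ _ (3%:E * ((2 `^ (3 / 2) / `|c| ^+ 3)%:E * (K%:E * \int[@leb3 R]_y G y)))%E).
  apply: lee_wpmul2l; first by rewrite lee_fin.
  apply: (@le_trans _ _ (\int[@leb3 R]_y \int[leb]_u P3 u y)%E).
    by apply: ge0_le_integralT => [y|y]; [exact: integral_ge0|exact: step2].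
  rewrite (fubini_tonelli (fun z => P3 z.2 z.1))//.
  apply: (@le_trans _ _ (\int[leb]_u ((2 `^ (3 / 2) / `|c| ^+ 3)%:E * ((decay u)%:E * \int[@leb3 R]_y G y)))%E).
    by apply: ge0_le_integralT => [u|u]; [exact: integral_ge0|exact: step3].
  have IG0 : (0 <= \int[@leb3 R]_y G y)%E by exact: integral_ge0.
  rewrite ge0_integralZl//; last 2 first.
  - by apply: emeasurable_funM => //; apply/measurable_EFinP; exact: measurable_decay.
  - by move=> u _; rewrite mule_ge0// lee_fin decay_ge0.
  apply: lee_wpmul2l; first by rewrite lee_fin divr_ge0 ?powR_ge0// exprn_ge0.
  rewrite ge0_integralZr//; last 2 first.
  - by apply/measurable_EFinP; exact: measurable_decay.
  - by move=> u _; rewrite lee_fin decay_ge0.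
  exact: lee_wpmul2r.
rewrite !muleA -!EFinM; apply: lee_wpmul2r; first exact: integral_ge0.
rewrite lee_fin -!mulrA ler_pM2l// ler_pM2l ?powR_gt0// mulrC.
by rewrite ler_pM2r ?invr_gt0 ?exprn_gt0 ?normr_gt0// (le_trans (ler_norm _))// lerDl.
Qed.

End spherical_coordinates.

(** * The integral over the collision parameters at fixed energy *)

Section inner_integral.
Context {R : realType}.
Local Notation mR := (measurableTypeR R).
Local Notation leb := (@lebesgue_measure R).
Local Notation mV := (mR * mR * mR)%type.

(** The choice a = 1, b = 0, c = sqrt E gives (v', I'), and a = -1, b = 1, c = - sqrt E gives (vs',
    Is'), so one estimate serves both. The affine substitution in r costs 1 / ((1 - q) E), which
    cancels the factor 1 - q, and the polar integral costs E^(-3/2). Here r ranges over the whole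
    line. *)
Lemma collision_angles_integral_le : exists2 K : R, 0 < K &
  forall (E a b c : R) (m : R * R * R) (g : mV * mR -> \bar R),
  0 < E -> `|a| = 1 -> `|c| = Num.sqrt E ->
  measurable_fun setT g -> (forall x, 0 <= g x)%E ->
  (\int[@sphere_measure R \xs (leb \xs leb)]_p
     ((Num.sqrt p.2.1 * (1 - p.2.1) * (0 < p.2.1 <= 1)%R%:R * (0 < norm3 p.1)%R%:R)%:E *
      g (m + scale3 (c * Num.sqrt p.2.1) p.1, (a * p.2.2 + b) * (1 - p.2.1) * E)%R)
   <= (K * E `^ (- (5 / 2)))%:E * \int[@leb3 R \xs leb]_x g x)%E.
Proof.
have [K K0 KP] := @polar_integral_le R.
exists K => // E a b c m g E0 a1 cE mg g0.
have Enz : E != 0 by rewrite gt_eqF.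
have sE0 : 0 < Num.sqrt E by rewrite sqrtr_gt0.
have c0 : c != 0 by rewrite -normr_gt0 cE.
pose kappa (q : mR) (w : mV) : R := Num.sqrt q * (0 < q <= 1)%R%:R * (0 < norm3 w)%R%:R.
have kappa0 q w : 0 <= kappa q w by rewrite !mulr_ge0// sqrtr_ge0.
pose F (z : mV * mR * mR) : \bar R := ((kappa z.1.2 z.1.1 * (1 - z.1.2))%:E *
  g (m + scale3 (c * Num.sqrt z.1.2) z.1.1, (a * z.2 + b) * (1 - z.1.2) * E)%R)%E.
have F0 z : (0 <= F z)%E.
  rewrite mule_ge0// lee_fin.
  have [/andP[_ q1]|qN] := boolP (0 < z.1.2 <= 1); first by rewrite mulr_ge0// subr_ge0.
  by rewrite /kappa (negbTE qN) !(mulr0, mul0r).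
have m1 : measurable_fun [set: mV * mR * mR] (fun z => z.1.1 : mV).
  exact: (measurableT_comp measurable_fst measurable_fst).
have m2 : measurable_fun [set: mV * mR * mR] (fun z => z.1.2 : mR).
  exact: (measurableT_comp measurable_snd measurable_fst).
have mF : measurable_fun setT F.
  apply: emeasurable_funM.
    apply/measurable_EFinP; apply: measurable_funM; last exact: measurable_funB.
    apply: measurable_funM; first apply: measurable_funM.
    - exact: measurable_sqrtr.
    - by apply: measurable_bool_natr; apply: measurable_and;
        [exact: measurable_fun_ltr|exact: measurable_fun_ler].
    - apply: measurable_bool_natr; apply: measurable_fun_ltr => //.
      exact: (measurableT_comp (@measurable_norm3 R)).
  apply: (measurableT_comp mg); apply: measurable_fun_pair.
    apply: measurable_scale_shift3 => //.
    by apply: measurable_funM => //; exact: measurable_sqrtr.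
  apply: measurable_funM => //; apply: measurable_funM; last exact: measurable_funB.
  by apply: measurable_funD => //; exact: measurable_funM.
pose F' (p : mV * (mR * mR)) : \bar R := F (p.1, p.2.1, p.2.2).
have mF' : measurable_fun setT F'.
  apply: (measurableT_comp mF); apply: measurable_fun_pair; first apply: measurable_fun_pair => //.
    exact: (measurableT_comp measurable_fst measurable_snd).
  exact: (measurableT_comp measurable_snd measurable_snd).
have F'0 p : (0 <= F' p)%E by exact: F0.
pose G (v : mV) : \bar R := (E^-1%:E * \int[leb]_I g (v, I))%E.
have mG : measurable_fun setT G.
  apply: emeasurable_funM => //.
  exact: (measurable_fun_fubini_tonelli_F (m2 := leb) _ mg).
have iE0 : 0 <= E^-1 by rewrite invr_ge0 ltW.
have G0 v : (0 <= G v)%E by rewrite mule_ge0 ?lee_fin//; exact: integral_ge0.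
pose Fr (z : mV * mR) : \bar R := (\int[leb]_r F (z, r))%E.
have mFr : measurable_fun setT Fr.
  exact: (measurable_fun_fubini_tonelli_F (m2 := leb) _ mF).
have Fr0 z : (0 <= Fr z)%E by exact: integral_ge0.
have FrG w q : (Fr (w, q) <= (kappa q w)%:E * G (m + scale3 (c * Num.sqrt q) w)%R)%E.
  have RG0 q' v : (0 <= (kappa q' w)%:E * G v)%E by rewrite mule_ge0 ?lee_fin.
  rewrite /Fr /F /=.
  have [/andP[q0 q1]|qN] := boolP (0 < q <= 1); last first.
    rewrite (_ : (fun r => _) = cst 0%E) ?integral0//.
    by apply/funext => r; rewrite /kappa (negbTE qN) !(mulr0, mul0r, mul0e).
  (* The substitution in r degenerates at q = 1, where the factor 1 - q makes the integrand
     vanish. *)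
  have [->|qn1] := eqVneq q 1.
    rewrite (_ : (fun r => _) = cst 0%E) ?integral0//.
    by apply/funext => r; rewrite subrr mulr0 mul0e.
  have q1' : 0 < 1 - q by rewrite subr_gt0 lt_neqAle qn1.
  have gm : measurable_fun setT (fun I : mR => g (m + scale3 (c * Num.sqrt q) w, I)).
    by apply: (measurableT_comp mg); exact: measurable_fun_pair.
  have aE : a * ((1 - q) * E) != 0.
    by rewrite -normr_gt0 normrM a1 mul1r normr_gt0 gt_eqF// mulr_gt0.
  rewrite ge0_integralZl//; last 2 first.
  - apply: (measurableT_comp gm); apply: measurable_funM => //; apply: measurable_funM => //.
    by apply: measurable_funD => //; exact: measurable_funM.
  - by rewrite lee_fin mulr_ge0// ltW.
  have -> : (\int[leb]_r g ((m + scale3 (c * Num.sqrt q) w)%R, ((a * r + b) * (1 - q) * E)%R) =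
     ((1 - q) * E)^-1%:E * \int[leb]_I g ((m + scale3 (c * Num.sqrt q) w)%R, I))%E.
    transitivity (\int[leb]_r g ((m + scale3 (c * Num.sqrt q) w)%R,
        (a * ((1 - q) * E) * r + b * ((1 - q) * E))%R))%E.
      by apply: eq_integral => r _; congr g; congr (_, _); ring.
    rewrite (ge0_integral_affine _ aE gm)// normrM a1 mul1r gtr0_norm//.
    by rewrite mulr_gt0.
  rewrite /G !muleA -!EFinM; apply: lee_wpmul2r; first exact: integral_ge0.
  by rewrite lee_fin -mulrA ler_wpM2l// invfM mulrA mulfV ?mul1r// gt_eqF.
apply: (@le_trans _ _ (\int[@sphere_measure R \xs (leb \xs leb)]_p F' p)%E).
  rewrite le_eqVlt; apply/orP; left; apply/eqP; apply: eq_integral => p _.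
  by rewrite /F' /F /kappa /=; congr (_%:E * _)%E; ring.
rewrite sigma_prod_tonelli1//.
apply: (@le_trans _ _ (\int[@sphere_measure R]_w \int[leb]_q Fr (w, q))%E).
  rewrite le_eqVlt; apply/orP; left; apply/eqP; apply: eq_integral => w _.
  rewrite sigma_prod_tonelli1//.
  by apply: (measurableT_comp mF'); exact: measurable_fun_pair.
rewrite (fubini_tonelli Fr mFr Fr0).
apply: (@le_trans _ _ (\int[leb]_q \int[@sphere_measure R]_w
    ((kappa q w)%:E * G (m + scale3 (c * Num.sqrt q) w)%R))%E).
  apply: ge0_le_integralT => q; first exact: integral_ge0.
  by apply: ge0_le_integralT => w.
apply: le_trans (KP c m G c0 mG G0) _.
rewrite (sigma_prod_tonelli1 _ _ mg g0) /G ge0_integralZl//; last 2 first.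
- exact: (measurable_fun_fubini_tonelli_F (m2 := leb) _ mg).
- by move=> v _; exact: integral_ge0.
rewrite muleA -EFinM; apply: lee_wpmul2r.
  by apply: integral_ge0 => v _; exact: integral_ge0.
rewrite lee_fin -mulrA ler_pM2l// cE.
have -> : Num.sqrt E ^+ 3 = E `^ (3 / 2).
  rewrite -powR12_sqrt ?(ltW E0)// -powR_mulrn ?powR_ge0// -powRrM.
  by congr (_ `^ _); field.
rewrite -powRN -[X in _ * X](@powR_inv1 _ E) ?(ltW E0)// -powRD ?Enz ?implybT//.
by rewrite (_ : - (3 / 2) + -1 = - (5 / 2)) //; field.
Qed.

End inner_integral.

(** * Pointwise bounds for the energy kernel *)

Section kernel.
Context {R : realType}.
Local Notation mR := (measurableTypeR R).
Local Notation leb := (@lebesgue_measure R).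
Implicit Types (v vs : R * R * R) (I Is x : R).

Lemma powRDgt0 x (p q : R) : 0 < x -> x `^ p * x `^ q = x `^ (p + q).
Proof. by move=> x0; rewrite powRD// (gt_eqF x0) implybT. Qed.

(** It suffices to bound (1 + |x|)^(5/2), hence the cube of 1 + |x|, by 27 e^(x^2 / 4). This is the
    cube of 1 + |x| <= 3 (1 + x^2 / 12) <= 3 e^(x^2 / 12). *)
Lemma gaussian_decay x : (1 + `|x|) * expR (- (x ^+ 2 / 4)) <= 27 * decay x.
Proof.
have n0 : 0 < 1 + `|x| by rewrite ltr_pwDl.
have n1 : 1 <= 1 + `|x| by rewrite lerDl.
have h1 : 1 + `|x| <= 3 * expR (x ^+ 2 / 12).
  apply: le_trans (_ : 3 * (1 + x ^+ 2 / 12) <= _); last by rewrite ler_pM2l// expR_ge1Dx.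
  by rewrite -real_normK ?num_real//; have := sqr_ge0 (`|x| - 2); lra.
have h3 : (1 + `|x|) ^+ 3 <= 27 * expR (x ^+ 2 / 4).
  rewrite (_ : 27 * _ = (3 * expR (x ^+ 2 / 12)) ^+ 3); last first.
    rewrite exprMn -expRM_natl; congr (_ * expR _); [ring|by field].
  by rewrite lerXn2r ?nnegrE ?mulr_ge0 ?expR_ge0// ltW.
rewrite expRN /decay powRN ler_pdivlMr ?powR_gt0// mulrAC ler_pdivrMr ?expR_gt0//.
apply: le_trans h3; rewrite exprS ler_pM2l// -powR_mulrn ?(ltW n0)//.
by rewrite ler_powR//; lra.
Qed.

(** The same device with an integer power N >= b + 3/2: raise 1 + y <= 2 N e^(y / (2 N)) to the
    power N. *)
Lemma exponential_decay (b : R) : 0 <= b -> exists2 C : R, 0 < C &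
  forall y, 0 < y -> y `^ b * expR (- (y / 2)) <= C * decay y.
Proof.
move=> b0; have [n nb] : exists n : nat, b + 3 / 2 <= n.+1%:R.
  exists (Num.truncn (b + 3 / 2)); exact/ltW/truncnS_gt.
set N : R := n.+1%:R in nb *.
have N0 : 0 < N by rewrite ltr0n.
exists ((2 * N) ^+ n.+1) => [|y y0]; first by rewrite exprn_gt0// mulr_gt0.
have n0 : 0 < 1 + y by rewrite addr_gt0.
have h1 : 1 + y <= 2 * N * expR (y / (2 * N)).
  apply: le_trans (_ : 2 * N * (1 + y / (2 * N)) <= _); last first.
    by rewrite ler_pM2l ?mulr_gt0// expR_ge1Dx.
  have N1 : 1 <= N by rewrite ler1n.
  by rewrite mulrDr mulr1 mulrCA mulfV ?mulr1 ?lerD2r ?mulf_neq0 ?gt_eqF//; lra.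
have h2 : (1 + y) ^+ n.+1 <= (2 * N) ^+ n.+1 * expR (y / 2).
  rewrite (_ : expR (y / 2) = expR (y / (2 * N)) ^+ n.+1); last first.
    by rewrite -expRM_natl; congr expR; rewrite -/N; field; rewrite gt_eqF.
  rewrite -exprMn lerXn2r ?nnegrE ?(ltW n0)// !mulr_ge0 ?expR_ge0//; exact: ltW.
rewrite expRN /decay powRN (gtr0_norm y0) ler_pdivlMr ?powR_gt0// mulrAC.
rewrite ler_pdivrMr ?expR_gt0//; apply: le_trans h2.
rewrite -powR_mulrn ?(ltW n0)//.
apply: (@le_trans _ _ ((1 + y) `^ b * (1 + y) `^ (3 / 2))).
  rewrite ler_wpM2r ?powR_ge0// ge0_ler_powR ?nnegrE ?(ltW n0) ?(ltW y0)//.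
  by rewrite lerDr.
by rewrite powRDgt0// ler_powR// lerDl ltW.
Qed.

Lemma norm3_le_sum v : norm3 v <= `|v.1.1| + `|v.1.2| + `|v.2|.
Proof.
rewrite -ler_sqr ?nnegrE ?norm3_ge0 ?addr_ge0// sqr_norm3.
rewrite -(real_normK (num_real v.1.1)) -(real_normK (num_real v.1.2)) -(real_normK (num_real v.2)).
have := normr_ge0 v.1.1; have := normr_ge0 v.1.2; have := normr_ge0 v.2.
nra.
Qed.

Lemma energyE v I vs Is : energy v I vs Is =
  ((v.1.1 - vs.1.1) ^+ 2 + (v.1.2 - vs.1.2) ^+ 2 + (v.2 - vs.2) ^+ 2) / 4 + I + Is.
Proof. by rewrite /energy sqr_norm3. Qed.

Lemma energy_gt0 v I vs Is : 0 < I -> 0 < Is -> 0 < energy v I vs Is.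
Proof. by move=> I0 Is0; rewrite /energy addr_gt0// ltr_wpDl// divr_ge0// sqr_ge0. Qed.

Lemma coord_le_energy (x E : R) : x ^+ 2 / 4 <= E -> `|x| <= 2 * Num.sqrt E.
Proof.
move=> xE; have E0 : 0 <= E by apply: le_trans xE; rewrite divr_ge0// sqr_ge0.
rewrite -ler_sqr ?nnegrE ?mulr_ge0 ?sqrtr_ge0// exprMn sqr_sqrtr// real_normK ?num_real//.
lra.
Qed.

(** The second hypothesis on x says |x| <= 2 sqrt E, and E <= 1/4 is exactly the condition that this
    bound is at most 1. *)
Lemma powR_sing (s x E : R) : 0 <= s -> 0 < E <= 4^-1 -> x ^+ 2 / 4 <= E ->
  ((E `^ (- (s / 2)))%:E <= (4 `^ s)%:E * sing s x)%E.
Proof.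
move=> s0 /andP[E0 E4] xE; set rho := 2 * Num.sqrt E.
have rho0 : 0 < rho by rewrite mulr_gt0// sqrtr_gt0.
have rho1 : rho <= 1.
  by rewrite -(@expr_le1 _ 2) ?(ltW rho0)// exprMn sqr_sqrtr ?(ltW E0)//; lra.
have rho01 : 0 < rho <= 1 by rewrite rho0.
apply: (@le_trans _ _ ((2 `^ s)%:E * (rho `^ (- s))%:E)%E).
  rewrite -EFinM lee_fin /rho powRM ?sqrtr_ge0// mulrA -powRD ?pnatr_eq0 ?implybT//.
  rewrite subrr powRr0 mul1r -powR12_sqrt ?(ltW E0)// -powRrM.
  by rewrite (_ : 2^-1 * - s = - (s / 2)) //; field.
apply: (@le_trans _ _ ((2 `^ s)%:E * ((2 `^ s)%:E * sing s x))%E).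
  apply: lee_wpmul2l; first by rewrite lee_fin powR_ge0.
  exact: sing_ge s0 rho01 (coord_le_energy xE).
by rewrite muleA -EFinM -powRM// -natrM.
Qed.

Definition sing3 (s : R) (u : R * R * R) : \bar R :=
  (sing s u.1.1 * sing s u.1.2 * sing s u.2)%E.

Lemma lee_EFin_pmulr (k : R) (X : \bar R) :
  0 <= k -> (1 <= X)%E -> (k%:E <= k%:E * X)%E.
Proof.
by move=> k0 X1; rewrite -[X in (X <= _)%E]mule1; apply: lee_wpmul2l.
Qed.

Lemma muleACA4 (a b c d x y z t : \bar R) :
  (a * x * (b * y) * (c * z) * (d * t) = a * b * c * d * (x * y * z * t))%E.
Proof.
by rewrite (muleACA a x b y) (muleACA (a * b) (x * y) c z)%E
  (muleACA (a * b * c) (x * y * z) d t)%E.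
Qed.

(* With s = (3 + alpha) / 5 < 1 the singularity splits as
   E^(-(3 + alpha) / 2) = (E^(-s / 2))^3 E^(-s), where E >= (vs - v)_i^2 / 4 and
   E >= Is: each of the four variables of integration gets an integrable power. *)
Lemma energy_power_bound (alpha : R) : 0 <= alpha -> alpha < 2 ->
  exists2 K : R, 0 < K & forall (v vs : R * R * R) (I Is : R), 0 < I -> 0 < Is ->
  (((1 + norm3 v + I `^ 4^-1) * energy v I vs Is `^ (- ((3 + alpha) / 2)))%:E <=
   (K * ((1 + `|vs.1.1|) * (1 + `|vs.1.2|) * (1 + `|vs.2|)))%:E *
   (sing3 ((3 + alpha) / 5) (vs - v)%R * sing ((3 + alpha) / 5) Is))%E.
Proof.
move=> a0 a2.
(* If E <= 1/4, then 1 + |v| + I^(1/4) <= 5 T, and the constants 4^s, 4^s, 4^s, 2^s multiply to at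
   most 128. If E > 1/4, the same sum is at most 10 T sqrt E, and sqrt E times the power of E is at
   most 16. *)
have [K [K0 K640 K160]] : exists K : R, [/\ 0 < K, 5 * 128 <= K & 10 * 16 <= K].
  by exists (5 * 128); split; lra.
exists K => // v vs I Is I0 Is0.
set E := energy v I vs Is; set s := (3 + alpha) / 5.
have E0 : 0 < E by exact: energy_gt0.
have s0 : 0 <= s by rewrite /s; lra.
have s1 : s <= 1 by rewrite /s; lra.
set e := Num.sqrt E; have e0 : 0 < e by rewrite sqrtr_gt0.
have Ee : E = e ^+ 2 by rewrite sqr_sqrtr ?(ltW E0).
have [x1 x2 x3] : [/\ (vs - v).1.1 ^+ 2 / 4 <= E, (vs - v).1.2 ^+ 2 / 4 <= E &
    (vs - v).2 ^+ 2 / 4 <= E].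
  have := sqr_ge0 (v.1.1 - vs.1.1); have := sqr_ge0 (v.1.2 - vs.1.2).
  have := sqr_ge0 (v.2 - vs.2); rewrite /E energyE /= => *.
  by split; rewrite -sqrrN opprB; lra.
have IE : I <= E by rewrite /E /energy; have := sqr_ge0 (norm3 (v - vs)); lra.
have IsE : Is <= E by rewrite /E /energy; have := sqr_ge0 (norm3 (v - vs)); lra.
set T := (1 + `|vs.1.1|) * (1 + `|vs.1.2|) * (1 + `|vs.2|).
have T1 : 1 + `|vs.1.1| + `|vs.1.2| + `|vs.2| <= T.
  rewrite /T; have := normr_ge0 vs.1.1; have := normr_ge0 vs.1.2; have := normr_ge0 vs.2.
  move: `|vs.1.1| `|vs.1.2| `|vs.2| => p q r r0 q0 p0.
  have := mulr_ge0 p0 q0; have := mulr_ge0 p0 r0; have := mulr_ge0 q0 r0.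
  have := mulr_ge0 (mulr_ge0 p0 q0) r0; lra.
have T11 : 1 <= T by apply: le_trans T1; rewrite -!addrA lerDl !addr_ge0.
(* Each coordinate of v differs from that of vs by at most 2 e, hence the term 6 e. *)
have vT : norm3 v <= (T - 1) + 6 * e.
  apply: le_trans (norm3_le_sum v) _.
  have tri (p q : R) : `|q - p| <= 2 * e -> `|p| <= `|q| + 2 * e.
    by move=> h; rewrite -lerBlDl (le_trans (lerB_dist _ _))// distrC.
  have := tri _ _ (coord_le_energy x1); have := tri _ _ (coord_le_energy x2).
  have := tri _ _ (coord_le_energy x3); lra.
have I4 : I `^ 4^-1 <= Num.sqrt e.
  rewrite -powR12_sqrt ?(ltW e0)// /e -powR12_sqrt ?(ltW E0)// -powRrM.
  rewrite (_ : 2^-1 * 2^-1 = 4^-1); last by field.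
  by rewrite ge0_ler_powR ?nnegrE ?(ltW I0) ?(ltW E0)// invr_ge0.
have S3 : (1 <= sing3 s (vs - v)%R)%E.
  rewrite /sing3 -[X in (X <= _)%E]mule1; apply: lee_pmul; rewrite ?sing_ge1//.
  by rewrite -[X in (X <= _)%E]mule1; apply: lee_pmul; rewrite ?sing_ge1.
have S0 : (0 <= sing3 s (vs - v)%R)%E by exact: le_trans S3.
have [E4|E4] := leP E 4^-1.
  have E01 : 0 < E <= 4^-1 by rewrite E0.
  have e12 : e <= 2^-1.
    by rewrite -(@ler_sqr _ e) ?nnegrE ?(ltW e0) ?invr_ge0// -Ee; lra.
  have se1 : Num.sqrt e <= 1 by rewrite -sqrtr1 ler_sqrt//; lra.
  apply: (@le_trans _ _ ((5 * T)%:E * (E `^ (- (s / 2)) * E `^ (- (s / 2)) * E `^ (- (s / 2)) * E `^ (- s))%:E)%E).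
    rewrite -EFinM lee_fin !powRDgt0//.
    rewrite (_ : - (s / 2) + - (s / 2) + - (s / 2) + - s = - ((3 + alpha) / 2)); last by rewrite /s; field.
    by rewrite ler_wpM2r ?powR_ge0//; lra.
  apply: (@le_trans _ _ ((5 * T)%:E * (((4 `^ s)%:E * sing s (vs - v)%R.1.1) * ((4 `^ s)%:E * sing s (vs - v)%R.1.2) *
      ((4 `^ s)%:E * sing s (vs - v)%R.2) * ((2 `^ s)%:E * sing s Is)))%E).
    apply: lee_wpmul2l; first by rewrite lee_fin mulr_ge0// (le_trans _ T11).
    have P0 : (0 <= (E `^ (- (s / 2)))%:E)%E by rewrite lee_fin powR_ge0.
    rewrite !EFinM; apply: lee_pmul; rewrite ?mule_ge0 ?lee_fin ?powR_ge0//.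
      apply: lee_pmul; rewrite ?mule_ge0 ?lee_fin ?powR_ge0//; last exact: powR_sing.
      by apply: lee_pmul; rewrite ?lee_fin ?powR_ge0//; exact: powR_sing.
    apply: sing_ge => //; first by rewrite E0 (le_trans E4)// invf_le1 ?ler1n.
    by rewrite gtr0_norm.
  have c4 : 4 `^ s <= 4 :> R by rewrite -[leRHS](@powRr1 R 4)// ler_powR// ler1n.
  have c2 : 2 `^ s <= 2 :> R by rewrite -[leRHS](@powRr1 R 2)// ler_powR// ler1n.
  rewrite muleACA4 -/(sing3 s _).
  rewrite muleA -EFinM; apply: lee_wpmul2r; first by rewrite mule_ge0// sing_ge0.
  have k0 : 0 <= 4 `^ s :> R by exact: powR_ge0.
  have K4 : 4 `^ s * 4 `^ s * 4 `^ s * 2 `^ s <= 128 :> R.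
    rewrite (_ : 128 = 4 * 4 * 4 * 2); last by ring.
    by rewrite !ler_pM// ?mulr_ge0 ?powR_ge0.
  rewrite lee_fin mulrAC ler_wpM2r ?(le_trans _ T11)//.
  by apply: le_trans K640; rewrite ler_pM2l.
have T0 : 0 <= T by rewrite (le_trans _ T11).
(* For E > 1/4 nothing is singular: the [sing] factors are inserted because they are at least 1, and
   one factor e = sqrt E of the decay in E pays for the growth in v and I. *)
apply: (@le_trans _ _ (K * T)%:E); last first.
  have SS : (1 <= sing3 s (vs - v)%R * sing s Is)%E.
    by rewrite -[X in (X <= _)%E]mule1; apply: lee_pmul => //; exact: sing_ge1.
  by rewrite lee_EFin_pmulr// mulr_ge0// ltW.
have e12 : 2^-1 < e.
  by rewrite -(@ltr_sqr _ 2^-1) ?nnegrE ?(ltW e0) ?invr_ge0// -Ee; lra.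
have se2 : Num.sqrt e <= 2 * e.
  rewrite -ler_sqr ?nnegrE ?sqrtr_ge0 ?mulr_ge0 ?(ltW e0)// sqr_sqrtr ?(ltW e0)//; nra.
have h : 1 + norm3 v + I `^ 4^-1 <= 10 * T * e.
  have : e <= T * e by rewrite ler_peMl// ltW.
  have : T <= 2 * (T * e) by nra.
  lra.
rewrite lee_fin; apply: (@le_trans _ _ (10 * T * e * E `^ (- ((3 + alpha) / 2)))).
  by rewrite ler_wpM2r ?powR_ge0.
apply: (@le_trans _ _ (10 * 16 * T)); last by rewrite ler_wpM2r.
rewrite -mulrA (mulrAC 10 16) ler_wpM2l ?mulr_ge0//.
rewrite {1}/e -powR12_sqrt ?(ltW E0)// powRDgt0//.
rewrite (_ : 2^-1 + _ = - (1 + alpha / 2)); last by field.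
rewrite powRN (le_trans (_ : _ <= (4^-1 `^ (1 + alpha / 2))^-1))//.
  rewrite lef_pV2 ?posrE ?powR_gt0// ge0_ler_powR ?nnegrE ?(ltW E0) ?(ltW E4)//; lra.
rewrite -powRN -powR_inv1// -powRrM (_ : -1 * - (1 + alpha / 2) = 1 + alpha / 2); last by ring.
rewrite (le_trans (_ : _ <= 4 `^ 2%:R))//; first by rewrite ler_powR//; lra.
by rewrite powR_mulrn// -natrX.
Qed.

End kernel.

(** * Integration of the kernel over (vs, Is) *)

Section kernel_integral.
Context {R : realType}.
Local Notation mR := (measurableTypeR R).
Local Notation leb := (@lebesgue_measure R).
Local Notation mV := (mR * mR * mR)%type.

Lemma leb3_integral_prod (X1 X2 X3 : mR -> \bar R) :
  measurable_fun setT X1 -> measurable_fun setT X2 -> measurable_fun setT X3 ->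
  (forall x, 0 <= X1 x)%E -> (forall x, 0 <= X2 x)%E -> (forall x, 0 <= X3 x)%E ->
  (\int[@leb3 R]_u (X1 u.1.1 * X2 u.1.2 * X3 u.2) =
   \int[leb]_x X1 x * \int[leb]_x X2 x * \int[leb]_x X3 x)%E.
Proof.
move=> m1 m2 m3 X10 X20 X30.
rewrite leb3_integral; last 2 first.
- apply: emeasurable_funM; first apply: emeasurable_funM.
  + exact: (measurableT_comp m1 (measurableT_comp measurable_fst measurable_fst)).
  + exact: (measurableT_comp m2 (measurableT_comp measurable_snd measurable_fst)).
  + exact: (measurableT_comp m3 measurable_snd).
- by move=> u; rewrite !mule_ge0.
have I20 : (0 <= \int[leb]_x X2 x)%E by exact: integral_ge0.
have I30 : (0 <= \int[leb]_x X3 x)%E by exact: integral_ge0.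
transitivity (\int[leb]_x (X1 x * (\int[leb]_x X2 x * \int[leb]_x X3 x)))%E; last first.
  by rewrite ge0_integralZr ?mule_ge0// muleA.
apply: eq_integral => x _ /=.
transitivity (\int[leb]_y (X1 x * (X2 y * \int[leb]_x X3 x)))%E.
  apply: eq_integral => y _; rewrite ge0_integralZl ?mule_ge0//.
  by rewrite muleA.
rewrite ge0_integralZl//; last 2 first.
- by apply: emeasurable_funM.
- by move=> y _; rewrite mule_ge0.
by rewrite ge0_integralZr.
Qed.

(** Pointwise the integrand is at most a constant over 1 + |v| + I^(1/4) times a product of four
    functions of one variable. The Gaussian turns each 1 + |vs_i| into [decay], the exponential does
    so with Is^a, and the energy contributes [sing] centred at v_i, or at 0 for Is. Each
    one-dimensional integral is bounded independently of v. *)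
Lemma kernel_integral_le (alpha a : R) : 0 <= alpha -> alpha < 2 -> 0 <= a ->
  exists2 K : R, 0 < K & forall (v : R * R * R) (I : R), 0 < I ->
  (\int[leb]_Is \int[@leb3 R]_vs
     ((0 < Is)%R%:R * (energy v I vs Is `^ ((2 - alpha) / 2) *
       (Is `^ a * expR (- (norm3 vs ^+ 2 / 4) - Is / 2))) *
      energy v I vs Is `^ (- (5 / 2)))%:E
   <= (K / (1 + norm3 v + I `^ 4^-1))%:E)%E.
Proof.
move=> al0 al2 a0.
have [K1 K10 K1P] := energy_power_bound al0 al2.
have [K2 K20 K2P] := exponential_decay a0.
set s := (3 + alpha) / 5 in K1P *.
have s1 : s < 1 by rewrite /s; lra.
have [K3 K30 K3P] := decay_sing_integral s1.
have [G G0 GP] : exists2 G : R, 0 < G &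
    forall x : R, (1 + `|x|) * expR (- (x ^+ 2 / 4)) <= G * decay x.
  by exists 27 => // x; exact: gaussian_decay.
have [K4 K40 K4E] : exists2 K4 : R, 0 < K4 & K4 = G * G * G * K2.
  by exists (G * G * G * K2) => //; rewrite !mulr_gt0.
exists (K1 * K4 * (K3 * K3 * K3 * K3)) => [|v I I0]; first by rewrite !mulr_gt0.
set D := 1 + norm3 v + I `^ 4^-1.
have D0 : 0 < D by rewrite ltr_wpDr ?powR_ge0// ltr_wpDr ?norm3_ge0.
pose X (x y : R) : \bar R := ((decay y)%:E * sing s (y - x)%R)%E.
have X0 x y : (0 <= X x y)%E by rewrite mule_ge0 ?sing_ge0// lee_fin decay_ge0.
have mX x : measurable_fun [set: mR] (X x).
  apply: emeasurable_funM; first by apply/measurable_EFinP; exact: measurable_decay.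
  by apply: (measurableT_comp (measurable_sing s)); exact: measurable_funB.
have c0 : (0 <= (K1 * K4 / D)%:E)%E.
  by rewrite lee_fin divr_ge0 ?mulr_ge0// ltW.
have pw vs Is : ((((0 < Is)%R%:R * (energy v I vs Is `^ ((2 - alpha) / 2) *
       (Is `^ a * expR (- (norm3 vs ^+ 2 / 4) - Is / 2))) *
      energy v I vs Is `^ (- (5 / 2)))%:E) <= (K1 * K4 / D)%:E *
      (X v.1.1 vs.1.1 * X v.1.2 vs.1.2 * X v.2 vs.2 * X 0%R Is))%E.
  have [Is0|_] := boolP (0 < Is); last first.
    rewrite !mul0r; apply: mule_ge0 => //; do 3?[apply: mule_ge0 => //].
  have E0 := energy_gt0 v vs I0 Is0; set E := energy v I vs Is in E0 *.
  set k := Is `^ a * expR (- (norm3 vs ^+ 2 / 4) - Is / 2).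
  have k0 : 0 <= k by rewrite mulr_ge0 ?powR_ge0 ?expR_ge0.
  set T := (1 + `|vs.1.1|) * (1 + `|vs.1.2|) * (1 + `|vs.2|).
  have Tk : T * k <= K4 * (decay vs.1.1 * decay vs.1.2 * decay vs.2 * decay Is).
    have -> : T * k = ((1 + `|vs.1.1|) * expR (- (vs.1.1 ^+ 2 / 4))) *
        ((1 + `|vs.1.2|) * expR (- (vs.1.2 ^+ 2 / 4))) *
        ((1 + `|vs.2|) * expR (- (vs.2 ^+ 2 / 4))) * (Is `^ a * expR (- (Is / 2))).
      rewrite /k sqr_norm3 (_ : - (_ / 4) - Is / 2 = - (vs.1.1 ^+ 2 / 4) +
        - (vs.1.2 ^+ 2 / 4) + - (vs.2 ^+ 2 / 4) + - (Is / 2)); last by field.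
      by rewrite !expRD /T; ring.
    rewrite K4E.
    rewrite (_ : G * G * G * K2 * _ = G * decay vs.1.1 * (G * decay vs.1.2) *
      (G * decay vs.2) * (K2 * decay Is)); last by ring.
    have g0 x : 0 <= (1 + `|x|) * expR (- (x ^+ 2 / 4)) by rewrite mulr_ge0 ?expR_ge0 ?addr_ge0.
    apply: ler_pM; rewrite ?K2P// ?mulr_ge0 ?powR_ge0 ?expR_ge0 ?addr_ge0//.
    apply: ler_pM; rewrite ?GP// ?mulr_ge0 ?expR_ge0 ?addr_ge0//.
    by apply: ler_pM; rewrite ?GP.
  have S0 : (0 <= sing3 s (vs - v)%R * sing s Is)%E by rewrite /sing3 !mule_ge0// sing_ge0.
  apply: (@le_trans _ _ ((k / D)%:E * ((K1 * T)%:E * (sing3 s (vs - v)%R * sing s Is)))%E).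
    apply: le_trans (_ : ((k / D)%:E * (D * E `^ (- ((3 + alpha) / 2)))%:E <= _)%E); last first.
      by apply: lee_wpmul2l; [rewrite lee_fin divr_ge0// ltW|exact: K1P].
    rewrite -EFinM lee_fin mul1r mulrAC powRDgt0//.
    rewrite (_ : (2 - alpha) / 2 + _ = - ((3 + alpha) / 2)); last by field.
    by rewrite [leRHS]mulrA divfK ?gt_eqF// mulrC.
  apply: (@le_trans _ _ ((K1 * K4 / D * (decay vs.1.1 * decay vs.1.2 * decay vs.2 * decay Is))%:E *
      (sing3 s (vs - v)%R * sing s Is))%E).
    rewrite muleA -EFinM; apply: lee_wpmul2r => //; rewrite lee_fin.
    rewrite (_ : k / D * (K1 * T) = K1 / D * (T * k)); last by ring.
    rewrite (_ : K1 * K4 / D * _ = K1 / D * (K4 * (decay vs.1.1 * decay vs.1.2 * decay vs.2 * decay Is))); last by ring.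
    by rewrite ler_wpM2l// divr_ge0// ltW.
  by rewrite /X muleACA4 subr0 EFinM !EFinM -!muleA.
apply: (@le_trans _ _ (\int[leb]_Is \int[@leb3 R]_vs ((K1 * K4 / D)%:E *
      (X v.1.1 vs.1.1 * X v.1.2 vs.1.2 * X v.2 vs.2 * X 0%R Is)))%E).
  have h0 (vs : mV) (Is : R) : (0 <= ((0 < Is)%R%:R * (energy v I vs Is `^ ((2 - alpha) / 2) *
       (Is `^ a * expR (- (norm3 vs ^+ 2 / 4) - Is / 2))) *
      energy v I vs Is `^ (- (5 / 2)))%:E)%E.
    by rewrite lee_fin !mulr_ge0 ?powR_ge0 ?expR_ge0.
  apply: ge0_le_integralT => Is; first by apply: integral_ge0 => vs _; exact: h0.
  by apply: ge0_le_integralT => vs; [exact: h0|exact: pw].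
set P := (\int[leb]_y X v.1.1 y * \int[leb]_y X v.1.2 y * \int[leb]_y X v.2 y)%E.
have PE : (\int[@leb3 R]_u (X v.1.1 u.1.1 * X v.1.2 u.1.2 * X v.2 u.2) = P)%E.
  by rewrite leb3_integral_prod.
have IX0 x : (0 <= \int[leb]_y X x y)%E by exact: integral_ge0.
have XK x : (\int[leb]_y X x y <= K3%:E)%E by exact: K3P.
have P0 : (0 <= P)%E by do 2?[apply: mule_ge0 => //].
have PK : (P <= (K3 * K3 * K3)%:E)%E.
  by rewrite /P !EFinM; apply: lee_pmul => //; first exact: mule_ge0; apply: lee_pmul.
have m3 : measurable_fun [set: mV] (fun u : mV => X v.1.1 u.1.1 * X v.1.2 u.1.2 * X v.2 u.2)%E.
  apply: emeasurable_funM; first apply: emeasurable_funM.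
  - exact: (measurableT_comp (mX _) (measurableT_comp measurable_fst measurable_fst)).
  - exact: (measurableT_comp (mX _) (measurableT_comp measurable_snd measurable_fst)).
  - exact: (measurableT_comp (mX _) measurable_snd).
apply: (@le_trans _ _ (\int[leb]_Is ((K1 * K4 / D)%:E * (P * X 0%R Is)))%E).
  rewrite le_eqVlt; apply/orP; left; apply/eqP; apply: eq_integral => Is _ /=.
  rewrite ge0_integralZl//; last 2 first.
  - exact: emeasurable_funM.
  - by move=> u _; do 3?[apply: mule_ge0 => //].
  by rewrite ge0_integralZr// ?PE// => u _; do 2?[apply: mule_ge0 => //].
rewrite ge0_integralZl//; last 2 first.
- exact: emeasurable_funM.
- by move=> Is _; rewrite mule_ge0.
rewrite ge0_integralZl// (mulrAC (K1 * K4)) [X in (_ <= X)%E]EFinM.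
apply: lee_wpmul2l => //.
by rewrite EFinM; apply: lee_pmul.
Qed.

End kernel_integral.

(** * Conservation of energy and the pointwise bound of the gain integrand *)

Section pointwise_gain_bound.
Context {R : realType}.
Implicit Types (v vs om : R * R * R) (I Is q r : R).

(** The cross terms in omega cancel and leave |v + vs|^2 / 4 + q E |omega|^2 + (1 - q) E, where
    |omega| = 1. *)
Lemma energy_conservation v I vs Is om q r :
  0 <= q -> 0 <= energy v I vs Is -> norm3 om = 1 ->
  norm3 (post_v v I vs Is om q) ^+ 2 / 2 + norm3 (post_vs v I vs Is om q) ^+ 2 / 2 +
    post_I v I vs Is q r + post_Is v I vs Is q r =
  norm3 v ^+ 2 / 2 + norm3 vs ^+ 2 / 2 + I + Is.
Proof.
move=> q0 E0 om1.
have om2 : om.1.1 ^+ 2 + om.1.2 ^+ 2 + om.2 ^+ 2 = 1 by rewrite -sqr_norm3 om1 expr1n.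
rewrite /post_I /post_Is !sqr_norm3 /post_v /post_vs /scale3 /=.
have sE : Num.sqrt (q * energy v I vs Is) ^+ 2 = q * energy v I vs Is.
  by rewrite sqr_sqrtr// mulr_ge0.
move: (Num.sqrt _) sE => S sE.
transitivity (((v.1.1 + vs.1.1) ^+ 2 + (v.1.2 + vs.1.2) ^+ 2 + (v.2 + vs.2) ^+ 2) / 4 +
  S ^+ 2 * (om.1.1 ^+ 2 + om.1.2 ^+ 2 + om.2 ^+ 2) + (1 - q) * energy v I vs Is).
  by field.
by rewrite om2 mulr1 sE energyE; field.
Qed.

(** With z = sqrt I, (|v| + z)^2 <= 4 (|v|^2 / 2 + z^2), which by the energy inequality is at most 8
    times the larger of the two squares (|v_i| + z_i)^2; 9 is the next square, whence the 3. *)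
Lemma weight_le (beta : R) v I v1 I1 v2 I2 :
  0 <= beta -> 0 <= I -> 0 <= I1 -> 0 <= I2 ->
  norm3 v ^+ 2 / 2 + I <= norm3 v1 ^+ 2 / 2 + I1 + (norm3 v2 ^+ 2 / 2 + I2) ->
  weight beta v I <= 3 `^ beta * weight beta v1 I1 \/
  weight beta v I <= 3 `^ beta * weight beta v2 I2.
Proof.
move=> b0 I0 I10 I20 e12; rewrite /weight.
have sI (J : R) : 0 <= J -> exists2 z, 0 <= z & J = z ^+ 2 /\ Num.sqrt J = z.
  by move=> J0; exists (Num.sqrt J); rewrite ?sqrtr_ge0// sqr_sqrtr.
have [z z0 [Iz ->]] := sI _ I0; have [z1 z10 [Iz1 ->]] := sI _ I10.
have [z2 z20 [Iz2 ->]] := sI _ I20.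
move: e12; rewrite Iz Iz1 Iz2.
have := norm3_ge0 v; have := norm3_ge0 v1; have := norm3_ge0 v2.
move: (norm3 v) (norm3 v1) (norm3 v2) => n n1 n2 n20 n10 n0 e12.
have main (x y : R) : 0 <= x -> 0 <= y -> (n + z) ^+ 2 <= 9 * (x + y) ^+ 2 ->
    (1 + n + z) `^ beta <= 3 `^ beta * (1 + x + y) `^ beta.
  move=> x0 y0 le9; rewrite -powRM ?addr_ge0// ge0_ler_powR ?nnegrE ?mulr_ge0 ?addr_ge0//.
  have : n + z <= 3 * (x + y).
    by rewrite -ler_sqr ?nnegrE ?mulr_ge0 ?addr_ge0// exprMn; lra.
  lra.
have sq (x y : R) : 0 <= x -> 0 <= y -> x ^+ 2 / 2 + y ^+ 2 <= (x + y) ^+ 2.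
  by move=> x0 y0; have := mulr_ge0 x0 y0; have := sqr_ge0 x; nra.
have h0 : (n + z) ^+ 2 <= 4 * (n ^+ 2 / 2 + z ^+ 2).
  by have := sqr_ge0 (n - z); have := sqr_ge0 z; nra.
have h1 := sq _ _ n10 z10; have h2 := sq _ _ n20 z20.
have [le12|/ltW le12] := leP (n1 + z1) (n2 + z2); [right|left]; apply: main => //.
  have : (n1 + z1) ^+ 2 <= (n2 + z2) ^+ 2 by rewrite lerXn2r ?nnegrE ?addr_ge0.
  have := sqr_ge0 (n2 + z2); lra.
have : (n2 + z2) ^+ 2 <= (n1 + z1) ^+ 2 by rewrite lerXn2r ?nnegrE ?addr_ge0.
have := sqr_ge0 (n1 + z1); lra.
Qed.

Definition maxwellian_cst (delta : R) : R := ((2 * pi) `^ (3 / 2) * Euler_gamma (delta / 2))^-1.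

Lemma maxwellian_cst_ge0 delta : 0 <= maxwellian_cst delta.
Proof.
rewrite invr_ge0 mulr_ge0 ?powR_ge0//; apply: fine_ge0; apply: integral_ge0 => s _.
by rewrite lee_fin mulr_ge0 ?powR_ge0 ?expR_ge0.
Qed.

Lemma sqrt_maxwellian delta v I : 0 <= I ->
  Num.sqrt (maxwellian delta v I) = Num.sqrt (maxwellian_cst delta) *
    I `^ ((delta / 2 - 1) / 2) * expR (- (norm3 v ^+ 2 / 4) - I / 2).
Proof.
move=> I0; rewrite /maxwellian -/(maxwellian_cst delta).
rewrite (mulrC (I `^ _)) !sqrtrM ?mulr_ge0 ?powR_ge0 ?maxwellian_cst_ge0//.
congr (_ * _ * _).
  by rewrite -powR12_sqrt ?powR_ge0// -powRrM.
rewrite (_ : - (norm3 v ^+ 2 / 2) - I =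
  - (norm3 v ^+ 2 / 4) - I / 2 + (- (norm3 v ^+ 2 / 4) - I / 2)); last by field.
by rewrite expRD -expr2 sqrtr_sqr ger0_norm// expR_ge0.
Qed.

(** With h = (delta / 2 - 1) / 2 >= 0, the powers of r, 1 - r, 1 - q, I, Is and E collapse to (r (1
    - r))^h (1 - q)^(2 h + 1) I^h Is^(2 h) E^(-2 h), the quantity [W] of the proof. As I and Is are
    at most E, it is at most (1 - q) Is^h. In the open ranges of q and r no denominator vanishes. *)
Lemma gain_integrand_le (alpha delta CB : R) (f : R -> R * R * R -> R * R * R -> R -> R)
    t x v I om q r vs Is :
  2 <= delta -> 0 <= CB -> 0 < I -> 0 < Is -> norm3 om = 1 -> 0 < q < 1 -> 0 < r < 1 ->
  `|(Num.sqrt (maxwellian delta v I))^-1 *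
    gain_integrand alpha delta CB
      (fun t x v I => Num.sqrt (maxwellian delta v I) * f t x v I)
      (fun t x v I => Num.sqrt (maxwellian delta v I) * f t x v I) t x v I om q r vs Is| <=
  CB * Num.sqrt (maxwellian_cst delta) *
  (energy v I vs Is `^ ((2 - alpha) / 2) *
    (Is `^ ((delta / 2 - 1) / 2) * expR (- (norm3 vs ^+ 2 / 4) - Is / 2))) *
  (Num.sqrt q * (1 - q)) *
  (`|f t x (post_v v I vs Is om q) (post_I v I vs Is q r)| *
   `|f t x (post_vs v I vs Is om q) (post_Is v I vs Is q r)|).
Proof.
move=> d2 CB0 I0 Is0 om1 /andP[q0 q1] /andP[r0 r1].
have E0 := energy_gt0 v vs I0 Is0.
have cons := energy_conservation r (ltW q0) (ltW E0) om1.
rewrite /gain_integrand /cross_section.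
have IE : post_I v I vs Is q r = r * (1 - q) * energy v I vs Is by [].
have IsE : post_Is v I vs Is q r = (1 - r) * (1 - q) * energy v I vs Is by [].
have IleE : I <= energy v I vs Is.
  by rewrite /energy; have := sqr_ge0 (norm3 (v - vs)); lra.
have IsleE : Is <= energy v I vs Is.
  by rewrite /energy; have := sqr_ge0 (norm3 (v - vs)); lra.
have q1' : 0 < 1 - q by rewrite subr_gt0.
have r1' : 0 < 1 - r by rewrite subr_gt0.
have I10 : 0 < post_I v I vs Is q r by rewrite IE !mulr_gt0.
have I20 : 0 < post_Is v I vs Is q r by rewrite IsE !mulr_gt0.
set E := energy v I vs Is in E0 IE IsE IleE IsleE *.
set f1 := f _ _ _ _; set f2 := f _ _ _ _.
rewrite !sqrt_maxwellian ?(ltW I0) ?(ltW I10) ?(ltW I20)//.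
set h := (delta / 2 - 1) / 2.
have h0 : 0 <= h by rewrite /h; lra.
have hh : delta / 2 - 1 = h + h by rewrite /h; field.
set v1 := post_v _ _ _ _ _ _ in cons *; set v2 := post_vs _ _ _ _ _ _ in cons *.
set I1 := post_I _ _ _ _ _ _ in cons IE I10 *; set I2 := post_Is _ _ _ _ _ _ in cons IsE I20 *.
set c := Num.sqrt (maxwellian_cst delta).
set e0 := expR (- (norm3 v ^+ 2 / 4) - I / 2).
set e1 := expR (- (norm3 v1 ^+ 2 / 4) - I1 / 2).
set e2 := expR (- (norm3 v2 ^+ 2 / 4) - I2 / 2).
set es := expR (- (norm3 vs ^+ 2 / 4) - Is / 2).
have ee : e1 * e2 = e0 * es.
  by rewrite /e1 /e2 /e0 /es -!expRD; congr expR; lra.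
have e00 : 0 < e0 by exact: expR_gt0.
have es0 : 0 < es by exact: expR_gt0.
have c0 : 0 <= c by exact: sqrtr_ge0.
set S := E `^ ((2 - alpha) / 2).
have S0 : 0 <= S by exact: powR_ge0.
set i := I `^ h; set j := Is `^ h; set e := E `^ h; set r1h := r `^ h; set r2h := (1 - r) `^ h.
set s := (1 - q) `^ h.
have i0 : 0 < i by exact: powR_gt0.
have j0 : 0 < j by exact: powR_gt0.
have ep : 0 < e by exact: powR_gt0.
have r1h0 : 0 < r1h by exact: powR_gt0.
have r2h0 : 0 < r2h by exact: powR_gt0.
have s0 : 0 < s by exact: powR_gt0.
have I1h : I1 `^ h = r1h * s * e by rewrite IE !powRM ?mulr_ge0 ?ltW.
have I2h : I2 `^ h = r2h * s * e by rewrite IsE !powRM ?mulr_ge0 ?ltW.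
have le1 (y : R) : 0 < y -> y <= 1 -> y `^ h <= 1.
  move=> y0 y1; apply: (@le_trans _ _ (1 `^ h)); last by rewrite powR1.
  by rewrite ge0_ler_powR ?nnegrE ?(ltW y0).
have r1h1 : r1h <= 1 by apply: le1 => //; exact: ltW.
have r2h1 : r2h <= 1 by apply: le1 => //; lra.
have s1 : s <= 1 by apply: le1 => //; lra.
have ie : i <= e by rewrite ge0_ler_powR ?nnegrE ?(ltW I0) ?(ltW E0).
have je : j <= e by rewrite ge0_ler_powR ?nnegrE ?(ltW Is0) ?(ltW E0).
have P1 : (I1 * I2) `^ (delta / 2 - 1) = (r1h * s * e * (r2h * s * e)) ^+ 2.
  by rewrite hh -powRDgt0 ?mulr_gt0// powRM ?(ltW I10) ?(ltW I20)// I1h I2h expr2.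
have P2 : (r * (1 - r)) `^ (delta / 2 - 1) = (r1h * r2h) ^+ 2.
  by rewrite hh -powRDgt0 ?mulr_gt0// powRM ?(ltW r0) ?(ltW r1')// expr2.
have P3 : (1 - q) `^ (delta - 1) = s ^+ 4 * (1 - q).
  rewrite (_ : delta - 1 = h + h + h + h + 1); last by rewrite /h; field.
  by rewrite -!powRDgt0// powRr1 ?(ltW q1')// -/s; ring.
have P4 : (I * Is) `^ (delta / 2 - 1) = (i * j) ^+ 2.
  by rewrite hh -powRDgt0 ?mulr_gt0// powRM ?(ltW I0) ?(ltW Is0)// expr2.
rewrite P1 P2 P3 P4 I1h I2h powR12_sqrt ?(ltW q0)//.
(* This holds for c = 0 too, as 0^-1 = 0. Afterwards [c^-1] becomes an independent symbol, since
   [field] would ask for c != 0. *)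
have cc : c^-1 * c * c = c.
  by have [->|cn0] := eqVneq c 0; rewrite ?mulr0// mulVf// mul1r.
set Q := Num.sqrt q; have Q0 : 0 <= Q by exact: sqrtr_ge0.
rewrite (invfM (c * i)) (invfM c); move: (c^-1) cc => ci cc.
set LHS := (X in `|X|).
have -> : LHS = CB * (ci * c * c) * S * ((e1 * e2) / e0) * (r1h * r2h * s ^+ 2 * (1 - q) * i * j ^+ 2 / e ^+ 2) * Q * (f1 * f2).
  by rewrite /LHS; field; rewrite !gt_eqF.
rewrite cc ee (_ : e0 * es / e0 = es); last by rewrite mulrAC mulfV ?mul1r// gt_eqF.
set W := r1h * r2h * s ^+ 2 * (1 - q) * i * j ^+ 2 / e ^+ 2.
have W0 : 0 <= W by rewrite /W divr_ge0 ?mulr_ge0 ?exprn_ge0 ?ltW.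
have Wle : W <= (1 - q) * j.
  rewrite /W ler_pdivrMr ?exprn_gt0//.
  rewrite (_ : r1h * r2h * s ^+ 2 * (1 - q) * i * j ^+ 2 =
    (r1h * r2h * s ^+ 2) * ((1 - q) * j * (i * j))); last by ring.
  rewrite -[leRHS]mul1r; apply: ler_pM; rewrite ?mulr_ge0 ?exprn_ge0 ?(ltW r1h0) ?(ltW r2h0) ?(ltW s0) ?(ltW i0) ?(ltW j0) ?(ltW q1')//.
    by rewrite mulr_ile1 ?mulr_ge0 ?exprn_ge0 ?mulr_ile1 ?exprn_ile1 ?(ltW r1h0) ?(ltW r2h0) ?(ltW s0).
  by rewrite expr2; apply: ler_wpM2l; rewrite ?mulr_ge0 ?(ltW j0) ?(ltW q1')//; apply: ler_pM => //; rewrite ltW.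
move: W W0 Wle => W W0 Wle; have es0w := ltW es0.
have CE0 : 0 <= CB * c * S * es by do 3?[apply: mulr_ge0 => //].
rewrite normrM (@ger0_norm _ (CB * c * S * es * W * Q)); last first.
  by do 2?[apply: mulr_ge0 => //].
rewrite normrM; apply: ler_wpM2r; first exact: mulr_ge0.
rewrite (_ : CB * c * (S * (j * es)) * (Q * (1 - q)) = CB * c * S * es * ((1 - q) * j) * Q); last by ring.
by apply: ler_wpM2r => //; apply: ler_wpM2l.
Qed.

End pointwise_gain_bound.

(** * Measurability of the collision maps *)

Section collision_maps.
Context d (T : measurableType d) (R : realType).
Local Notation mR := (measurableTypeR R).
Local Notation mV := (mR * mR * mR)%type.
Variables (vs om : T -> mV) (Is q r : T -> mR) (v : R * R * R) (I : R).
Hypotheses (mvs : measurable_fun setT vs) (mom : measurable_fun setT om).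
Hypotheses (mIs : measurable_fun setT Is) (mq : measurable_fun setT q).
Hypothesis mr : measurable_fun setT r.

Lemma measurable_energy : measurable_fun setT (fun p => energy v I (vs p) (Is p) : mR).
Proof.
rewrite /energy; apply: measurable_funD => //; apply: measurable_funD => //.
apply: measurable_funM => //; apply: measurable_funX.
apply: (measurableT_comp (@measurable_norm3 R)).
rewrite (_ : (fun p => v - vs p) = (fun p => v + scale3 (- 1) (vs p))).
  exact: measurable_scale_shift3.
by apply/funext => p; rewrite /scale3 !mulN1r.
Qed.

Let measurable_mean : measurable_fun setT (fun p => scale3 2^-1 (v + vs p) : mV).
Proof.
rewrite (_ : (fun p => _) = (fun p => scale3 2^-1 v + scale3 2^-1 (vs p))).
  exact: measurable_scale_shift3.
by apply/funext => p; rewrite /scale3 /= !mulrDr.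
Qed.

Let measurable_speed : measurable_fun setT (fun p => Num.sqrt (q p * energy v I (vs p) (Is p)) : mR).
Proof.
by apply: measurable_sqrtr; apply: measurable_funM => //; exact: measurable_energy.
Qed.

Lemma measurable_post_v :
  measurable_fun setT (fun p => post_v v I (vs p) (Is p) (om p) (q p) : mV).
Proof. by rewrite /post_v; exact: measurable_scale_shift3. Qed.

Lemma measurable_post_vs :
  measurable_fun setT (fun p => post_vs v I (vs p) (Is p) (om p) (q p) : mV).
Proof.
rewrite /post_vs (_ : (fun p => _) = (fun p => scale3 2^-1 (v + vs p) +
  scale3 (- Num.sqrt (q p * energy v I (vs p) (Is p))) (om p))).
  by apply: measurable_scale_shift3 => //; exact: measurable_funN.
by apply/funext => p; rewrite /scale3 /= !mulNr.
Qed.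

Lemma measurable_post_I :
  measurable_fun setT (fun p => post_I v I (vs p) (Is p) (q p) (r p) : mR).
Proof.
rewrite /post_I; apply: measurable_funM; last exact: measurable_energy.
by apply: measurable_funM => //; exact: measurable_funB.
Qed.

Lemma measurable_post_Is :
  measurable_fun setT (fun p => post_Is v I (vs p) (Is p) (q p) (r p) : mR).
Proof.
rewrite /post_Is; apply: measurable_funM; last exact: measurable_energy.
by apply: measurable_funM; exact: measurable_funB.
Qed.

End collision_maps.

(** * Comparison of the gain integrand with [g], and its integration *)

Section gain_bound.
Context {R : realType}.
Local Notation mR := (measurableTypeR R).
Local Notation leb := (@lebesgue_measure R).
Local Notation mV := (mR * mR * mR)%type.

(* [g] is L |f|, except that it is +oo where the bound w |f| <= L may fail and on
   the null set I = 0, which is reached by the collision map for r = 0 and r = 1. *)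
Definition majorant (beta L : R) (f : R * R * R -> R -> R) (g : mV * mR -> \bar R) :=
  forall v I, 0 <= I -> g (v, I) = +oo%E \/
    [/\ 0 < I, weight beta v I * `|f v I| <= L & g (v, I) = (L * `|f v I|)%:E].

(** Where one value of [g] is +oo, nonnegativity of the other keeps the sum at +oo; a sum is used
    because either weight may be the dominating one. *)
Lemma weighted_product_le (beta L : R) (f : R * R * R -> R -> R) g v I v1 I1 v2 I2 :
  majorant beta L f g -> 0 <= beta -> 0 <= L -> 0 <= I -> 0 <= I1 -> 0 <= I2 ->
  norm3 v ^+ 2 / 2 + I <= norm3 v1 ^+ 2 / 2 + I1 + (norm3 v2 ^+ 2 / 2 + I2) ->
  (forall x, 0 <= g x)%E ->
  ((weight beta v I * (`|f v1 I1| * `|f v2 I2|))%:E <=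
    (3 `^ beta)%:E * (g (v1, I1) + g (v2, I2)))%E.
Proof.
move=> fg b0 L0 I0 I10 I20 e12 g0.
have B0 : 0 < 3 `^ beta :> R by rewrite powR_gt0.
have Boo (y : \bar R) : y = +oo%E -> ((3 `^ beta)%:E * y = +oo)%E.
  by move=> ->; rewrite gt0_muley// lte_fin.
have [g1|[I1p w1 g1]] := fg v1 I1 I10.
  by rewrite Boo ?leey// g1 addye// gt_eqF// (lt_le_trans _ (g0 _)) ?ltNyr.
have [g2|[I2p w2 g2]] := fg v2 I2 I20.
  by rewrite Boo ?leey// g2 addey// gt_eqF// (lt_le_trans _ (g0 _)) ?ltNyr.
rewrite g1 g2 -EFinD -EFinM lee_fin.
have [le|le] := weight_le b0 I0 I10 I20 e12.
  apply: (@le_trans _ _ (3 `^ beta * weight beta v1 I1 * (`|f v1 I1| * `|f v2 I2|))).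
    by rewrite ler_wpM2r// mulr_ge0.
  rewrite -mulrA ler_pM2l// mulrA (le_trans (ler_wpM2r _ w1))//.
  by rewrite lerDr mulr_ge0.
apply: (@le_trans _ _ (3 `^ beta * weight beta v2 I2 * (`|f v1 I1| * `|f v2 I2|))).
  by rewrite ler_wpM2r// mulr_ge0.
rewrite -mulrA ler_pM2l// mulrCA (le_trans (ler_wpM2l _ w2))//.
by rewrite mulrC lerDl mulr_ge0.
Qed.

(** Carries the interior bound to the closed ranges of q and r. The integrand vanishes for q = 0 and
    q = 1. For r = 0 or r = 1 one internal energy is 0, where [g] is +oo, and so is the right-hand
    side as soon as its coefficient is positive; the summand 1 next to the normalizing constant
    secures that positivity when CB > 0. *)
Lemma sqrtM_gain_le (alpha delta CB beta L : R) (f : R -> R * R * R -> R * R * R -> R -> R)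
    (g : mV * mR -> \bar R) t x v I om q r vs Is :
  2 <= delta -> 0 <= CB -> 0 <= beta -> 0 <= L ->
  majorant beta L (f t x) g -> (forall y, 0 <= g y)%E ->
  0 < I -> 0 < Is -> norm3 om = 1 -> 0 <= q <= 1 -> 0 <= r <= 1 ->
  ((weight beta v I * `|(Num.sqrt (maxwellian delta v I))^-1 *
    gain_integrand alpha delta CB
      (fun t x v I => Num.sqrt (maxwellian delta v I) * f t x v I)
      (fun t x v I => Num.sqrt (maxwellian delta v I) * f t x v I) t x v I om q r vs Is|)%:E <=
  (CB * (Num.sqrt (maxwellian_cst delta) + 1) * 3 `^ beta *
   (energy v I vs Is `^ ((2 - alpha) / 2) *
    (Is `^ ((delta / 2 - 1) / 2) * expR (- (norm3 vs ^+ 2 / 4) - Is / 2))) *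
   (Num.sqrt q * (1 - q)))%:E *
  (g (post_v v I vs Is om q, post_I v I vs Is q r) +
   g (post_vs v I vs Is om q, post_Is v I vs Is q r)))%E.
Proof.
move=> d2 CB0 b0 L0 fg g0 I0 Is0 om1 /andP[q0 q1] /andP[r0 r1].
have gg0 : (0 <= g (post_v v I vs Is om q, post_I v I vs Is q r) +
   g (post_vs v I vs Is om q, post_Is v I vs Is q r))%E by rewrite adde_ge0.
have E0 := energy_gt0 v vs I0 Is0.
have A0 : 0 <= CB * (Num.sqrt (maxwellian_cst delta) + 1) * 3 `^ beta *
   (energy v I vs Is `^ ((2 - alpha) / 2) *
    (Is `^ ((delta / 2 - 1) / 2) * expR (- (norm3 vs ^+ 2 / 4) - Is / 2))) *
   (Num.sqrt q * (1 - q)).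
  by rewrite !mulr_ge0 ?powR_ge0 ?expR_ge0 ?subr_ge0 ?addr_ge0 ?sqrtr_ge0.
set G := gain_integrand _ _ _ _ _ _ _ _ _ _ _ _ _ _.
have Gle : G = 0 -> forall X : \bar R, (0 <= X)%E ->
    ((weight beta v I * `|(Num.sqrt (maxwellian delta v I))^-1 * G|)%:E <= X)%E.
  by move=> -> X X0; rewrite mulr0 normr0 mulr0.
have [q00|qn0] := eqVneq q 0.
  apply: Gle; last by rewrite mule_ge0 ?lee_fin.
  by rewrite /G /gain_integrand q00 powR0 ?invr_neq0// !(mulr0, mul0r).
have [q11|qn1] := eqVneq q 1.
  apply: Gle; last by rewrite mule_ge0 ?lee_fin.
  have d1 : delta - 1 != 0 by rewrite gt_eqF//; lra.
  by rewrite /G /gain_integrand q11 subrr (powR0 d1) !(mulr0, mul0r).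
have qp : 0 < q by rewrite lt_neqAle eq_sym qn0.
have q1p : 0 < 1 - q by rewrite subr_gt0 lt_neqAle qn1.
set A := (X in (_ <= X%:E * _)%E) in A0 *.
have I1E : post_I v I vs Is q r = r * (1 - q) * energy v I vs Is by [].
have I2E : post_Is v I vs Is q r = (1 - r) * (1 - q) * energy v I vs Is by [].
have I10 : 0 <= post_I v I vs Is q r.
  by rewrite I1E !mulr_ge0// ltW.
have I20 : 0 <= post_Is v I vs Is q r.
  by rewrite I2E !mulr_ge0 ?subr_ge0// ltW.
have [CB00|CBn0] := eqVneq CB 0.
  apply: Gle; last by rewrite mule_ge0 ?lee_fin.
  by rewrite /G /gain_integrand /cross_section CB00 !mul0r.
have Ap : 0 < A.
  have CBp : 0 < CB by rewrite lt_neqAle eq_sym CBn0.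
  have cp : 0 < Num.sqrt (maxwellian_cst delta) + 1 by rewrite ltr_wpDl ?sqrtr_ge0.
  by rewrite /A !mulr_gt0 ?powR_gt0 ?expR_gt0 ?sqrtr_gt0.
have [rr|/andP rr] := boolP (0 < r < 1); last first.
  have rr0 : r = 0 \/ r = 1.
    have [->|rn0] := eqVneq r 0; first by left.
    have [->|rn1] := eqVneq r 1; first by right.
    by case: rr; rewrite !lt_neqAle eq_sym rn0 rn1.
  have Aoo (y : \bar R) : y = +oo%E -> (A%:E * y = +oo)%E.
    by move=> ->; rewrite gt0_muley// lte_fin.
  case: rr0 => rr0.
    have I1z : post_I v I vs Is q r = 0 by rewrite I1E rr0 !mul0r.
    have [g1|[]] := fg (post_v v I vs Is om q) _ I10; last by rewrite I1z ltxx.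
    by rewrite Aoo ?leey// g1 addye// gt_eqF// (lt_le_trans _ (g0 _)) ?ltNyr.
  have I2z : post_Is v I vs Is q r = 0 by rewrite I2E rr0 subrr !mul0r.
  have [g2|[]] := fg (post_vs v I vs Is om q) _ I20; last by rewrite I2z ltxx.
  by rewrite Aoo ?leey// g2 addey// gt_eqF// (lt_le_trans _ (g0 _)) ?ltNyr.
have qq : 0 < q < 1 by rewrite qp -subr_gt0.
have w0 : 0 <= weight beta v I by exact: powR_ge0.
have cons := energy_conservation r q0 (ltW E0) om1.
have wle := weighted_product_le fg b0 L0 (ltW I0) I10 I20.
have {}wle : ((weight beta v I *
    (`|f t x (post_v v I vs Is om q) (post_I v I vs Is q r)| *
     `|f t x (post_vs v I vs Is om q) (post_Is v I vs Is q r)|))%:E <=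
   (3 `^ beta)%:E * (g (post_v v I vs Is om q, post_I v I vs Is q r) +
   g (post_vs v I vs Is om q, post_Is v I vs Is q r)))%E.
  by apply: wle => //; have := sqr_ge0 (norm3 vs); lra.
have gle := gain_integrand_le alpha f t x v vs d2 CB0 I0 Is0 om1 qq rr; rewrite -/G in gle.
set P := `|f t x _ _| * `|f t x _ _| in wle gle.
set k := energy v I vs Is `^ _ * _ in gle A0 Ap *.
have k0 : 0 <= k by rewrite !mulr_ge0 ?powR_ge0 ?expR_ge0.
have P0 : 0 <= P by rewrite mulr_ge0.
have Q0 : 0 <= Num.sqrt q * (1 - q) by rewrite mulr_ge0 ?sqrtr_ge0 ?(ltW q1p).
have c1 : 0 <= Num.sqrt (maxwellian_cst delta) + 1 by rewrite addr_ge0 ?sqrtr_ge0.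
pose D := CB * (Num.sqrt (maxwellian_cst delta) + 1) * k * (Num.sqrt q * (1 - q)).
have D0 : 0 <= D by do 3?[apply: mulr_ge0 => //].
apply: (@le_trans _ _ (D%:E * (weight beta v I * P)%:E)%E).
  rewrite -EFinM lee_fin [leRHS]mulrCA ler_wpM2l//; apply: le_trans gle _.
  rewrite ler_wpM2r// ler_wpM2r// ler_wpM2r// ler_wpM2l// lerDl//.
apply: (le_trans (lee_wpmul2l _ wle)); first by rewrite lee_fin.
by rewrite muleA -EFinM (_ : D * 3 `^ beta = A)// /D /A /k; ring.
Qed.

(** The collision domain is replaced by indicator factors on the whole product space, to which
    Tonelli's theorem applies; |omega| = 1 is relaxed to omega != 0 and r ranges over the whole
    line. *)
Lemma collision_integral_le (alpha a : R) : 0 <= alpha -> alpha < 2 -> 0 <= a ->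
  exists2 K : R, 0 < K & forall (v : R * R * R) (I : R) (g : mV * mR -> \bar R),
  0 < I -> measurable_fun setT g -> (forall y, 0 <= g y)%E ->
  (\int[@collision_measure R]_p
    (((0 < p.2)%R%:R * (energy v I p.1.2 p.2 `^ ((2 - alpha) / 2) *
       (p.2 `^ a * expR (- (norm3 p.1.2 ^+ 2 / 4) - p.2 / 2))) *
      (Num.sqrt p.1.1.2.1 * (1 - p.1.1.2.1) * (0 < p.1.1.2.1 <= 1)%R%:R *
       (0 < norm3 p.1.1.1)%R%:R))%:E *
     (g (post_v v I p.1.2 p.2 p.1.1.1 p.1.1.2.1, post_I v I p.1.2 p.2 p.1.1.2.1 p.1.1.2.2) +
      g (post_vs v I p.1.2 p.2 p.1.1.1 p.1.1.2.1, post_Is v I p.1.2 p.2 p.1.1.2.1 p.1.1.2.2)))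
   <= (K / (1 + norm3 v + I `^ 4^-1))%:E * \int[@leb3 R \xs leb]_y g y)%E.
Proof.
move=> al0 al2 a0.
have [K1 K10 K1P] := kernel_integral_le al0 al2 a0.
have [K2 K20 K2P] := @collision_angles_integral_le R.
exists (K1 * (K2 + K2)) => [|v I g I0 mg g0]; first by rewrite !mulr_gt0// addr_gt0.
pose A (vs : mV) (Is : mR) : R := (0 < Is)%R%:R * (energy v I vs Is `^ ((2 - alpha) / 2) *
       (Is `^ a * expR (- (norm3 vs ^+ 2 / 4) - Is / 2))).
pose kap (om : mV) (q : mR) : R := Num.sqrt q * (1 - q) * (0 < q <= 1)%R%:R * (0 < norm3 om)%R%:R.
have A0 vs Is : 0 <= A vs Is by rewrite !mulr_ge0 ?powR_ge0 ?expR_ge0.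
have kap0 om q : 0 <= kap om q.
  rewrite /kap; have [/andP[_ q1]|_] := boolP (0 < q <= 1).
    by rewrite !mulr_ge0 ?sqrtr_ge0 ?subr_ge0.
  by rewrite mulr0 mul0r.
pose mPt := (mV * (mR * mR) * mV * mR)%type.
pose H (p : mPt) : \bar R := ((A p.1.2 p.2 * kap p.1.1.1 p.1.1.2.1)%:E *
     (g (post_v v I p.1.2 p.2 p.1.1.1 p.1.1.2.1, post_I v I p.1.2 p.2 p.1.1.2.1 p.1.1.2.2) +
      g (post_vs v I p.1.2 p.2 p.1.1.1 p.1.1.2.1, post_Is v I p.1.2 p.2 p.1.1.2.1 p.1.1.2.2)))%E.
have H0 p : (0 <= H p)%E by rewrite mule_ge0 ?adde_ge0// lee_fin mulr_ge0.
change (\int[@collision_measure R]_p H p <=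
  (K1 * (K2 + K2) / (1 + norm3 v + I `^ 4^-1))%:E * \int[@leb3 R \xs leb]_y g y)%E.
have mA2 : measurable_fun setT (fun z : mV * mR => A z.1 z.2 : mR).
  apply: measurable_funM; first by apply: measurable_bool_natr; exact: measurable_fun_ltr.
  apply: measurable_funM.
    by apply: measurable_powRr; apply: measurable_energy => //.
  apply: measurable_funM; first by apply: measurable_powRr; exact: measurable_snd.
  apply: measurableT_comp => //; apply: measurable_funB; last exact: measurable_funM.
  apply: measurable_funN; apply: measurable_funM => //; apply: measurable_funX.
  exact: (measurableT_comp (@measurable_norm3 R)).
have mk2 : measurable_fun setT (fun z : mV * mR => kap z.1 z.2 : mR).
  apply: measurable_funM; first apply: measurable_funM; first apply: measurable_funM.
  - exact: measurable_sqrtr.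
  - exact: measurable_funB.
  - by apply: measurable_bool_natr; apply: measurable_and;
      [exact: measurable_fun_ltr|exact: measurable_fun_ler].
  - apply: measurable_bool_natr; apply: measurable_fun_ltr => //.
    exact: (measurableT_comp (@measurable_norm3 R)).
have m1 : measurable_fun [set: mPt] (fun p => p.1.2 : mV).
  exact: (measurableT_comp measurable_snd measurable_fst).
have m2 : measurable_fun [set: mPt] (fun p => p.2 : mR) by exact: measurable_snd.
have m11 : measurable_fun [set: mPt] (fun p => p.1.1 : mV * (mR * mR)).
  exact: (measurableT_comp measurable_fst measurable_fst).
have m3 : measurable_fun [set: mPt] (fun p => p.1.1.1 : mV).
  exact: (measurableT_comp measurable_fst m11).
have m4 : measurable_fun [set: mPt] (fun p => p.1.1.2.1 : mR).
  exact: (measurableT_comp measurable_fst (measurableT_comp measurable_snd m11)).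
have m5 : measurable_fun [set: mPt] (fun p => p.1.1.2.2 : mR).
  exact: (measurableT_comp measurable_snd (measurableT_comp measurable_snd m11)).
have mH : measurable_fun [set: mPt] H.
  apply: emeasurable_funM.
    apply/measurable_EFinP; apply: measurable_funM.
      exact: (measurableT_comp mA2 (measurable_fun_pair m1 m2)).
    exact: (measurableT_comp mk2 (measurable_fun_pair m3 m4)).
  apply: emeasurable_funD; apply: (measurableT_comp mg); apply: measurable_fun_pair.
  - exact: measurable_post_v.
  - exact: measurable_post_I.
  - exact: measurable_post_vs.
  - exact: measurable_post_Is.
set IG := (\int[@leb3 R \xs leb]_y g y)%E.
have IG0 : (0 <= IG)%E by exact: integral_ge0.
have inner (vs : mV) (Is : mR) : (\int[@sphere_measure R \xs (leb \xs leb)]_s H (s, vs, Is) <=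
    (A vs Is * energy v I vs Is `^ (- (5 / 2)))%:E * ((K2 + K2)%:E * IG))%E.
  have [Is0|IsN] := boolP (0 < Is); last first.
    have Az : A vs Is = 0 by rewrite /A (negbTE IsN) mul0r.
    rewrite (_ : (fun s => _) = cst 0%E) ?integral0 ?Az ?mul0r ?mul0e//.
    by apply/funext => s; rewrite /H /= Az mul0r mul0e.
  have E0 := energy_gt0 v vs I0 Is0; set E := energy v I vs Is in E0 *.
  have sE q : Num.sqrt (q * E) = Num.sqrt E * Num.sqrt q by rewrite mulrC sqrtrM ?(ltW E0).
  pose J1 (s : mV * (mR * mR)) : \bar R := ((kap s.1 s.2.1)%:E *
    g (post_v v I vs Is s.1 s.2.1, post_I v I vs Is s.2.1 s.2.2))%E.
  pose J2 (s : mV * (mR * mR)) : \bar R := ((kap s.1 s.2.1)%:E *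
    g (post_vs v I vs Is s.1 s.2.1, post_Is v I vs Is s.2.1 s.2.2))%E.
  have J10 s : (0 <= J1 s)%E by apply: mule_ge0; rewrite ?lee_fin.
  have J20 s : (0 <= J2 s)%E by apply: mule_ge0; rewrite ?lee_fin.
  have n1 : measurable_fun [set: mV * (mR * mR)] (fun s => s.2.1 : mR).
    exact: (measurableT_comp measurable_fst measurable_snd).
  have n2 : measurable_fun [set: mV * (mR * mR)] (fun s => s.2.2 : mR).
    exact: (measurableT_comp measurable_snd measurable_snd).
  have mk3 : measurable_fun [set: mV * (mR * mR)] (fun s => (kap s.1 s.2.1)%:E).
    by apply/measurable_EFinP; exact: (measurableT_comp mk2 (measurable_fun_pair measurable_fst n1)).
  have mJ1 : measurable_fun setT J1.
    apply: emeasurable_funM => //; apply: (measurableT_comp mg); apply: measurable_fun_pair.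
      exact: measurable_post_v.
    exact: measurable_post_I.
  have mJ2 : measurable_fun setT J2.
    apply: emeasurable_funM => //; apply: (measurableT_comp mg); apply: measurable_fun_pair.
      exact: measurable_post_vs.
    exact: measurable_post_Is.
  have J1le : (\int[@sphere_measure R \xs (leb \xs leb)]_s J1 s <= (K2 * E `^ (- (5 / 2)))%:E * IG)%E.
    have sEn : `|Num.sqrt E| = Num.sqrt E by rewrite ger0_norm// sqrtr_ge0.
    have := K2P E 1 0 (Num.sqrt E) (scale3 2^-1 (v + vs)) g E0 (normr1 _) sEn mg g0.
    apply: le_trans; rewrite le_eqVlt; apply/orP; left; apply/eqP; apply: eq_integral => s _.
    rewrite /J1 /kap /post_v /post_I -/E sE; congr (_ * g (_, _))%E.
    by ring.
  have J2le : (\int[@sphere_measure R \xs (leb \xs leb)]_s J2 s <= (K2 * E `^ (- (5 / 2)))%:E * IG)%E.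
    have sEn : `|- Num.sqrt E| = Num.sqrt E by rewrite normrN ger0_norm// sqrtr_ge0.
    have := K2P E (-1) 1 (- Num.sqrt E) (scale3 2^-1 (v + vs)) g E0 (normrN1 _) sEn mg g0.
    apply: le_trans; rewrite le_eqVlt; apply/orP; left; apply/eqP; apply: eq_integral => s _.
    rewrite /J2 /kap /post_vs /post_Is -/E sE; congr (_ * g (_, _))%E.
      by rewrite /scale3 /= !mulNr.
    by ring.
  have -> : (\int[@sphere_measure R \xs (leb \xs leb)]_s H (s, vs, Is) =
      (A vs Is)%:E * (\int[@sphere_measure R \xs (leb \xs leb)]_s J1 s +
        \int[@sphere_measure R \xs (leb \xs leb)]_s J2 s))%E.
    rewrite -ge0_integralD// -ge0_integralZl//; last 3 first.
    - exact: emeasurable_funD.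
    - by move=> s _; exact: adde_ge0.
    - by rewrite lee_fin.
    apply: eq_integral => s _; rewrite /H /J1 /J2 /= -muleDr//.
      by rewrite EFinM muleA.
    by apply: ge0_adde_def; rewrite inE.
  rewrite (EFinM (A vs Is)) -muleA; apply: lee_wpmul2l; first by rewrite lee_fin.
  apply: (le_trans (leeD J1le J2le)).
  rewrite -ge0_muleDl ?lee_fin ?mulr_ge0 ?powR_ge0 ?(ltW K20)//.
  by rewrite muleA -EFinM -EFinD (_ : K2 * _ + _ = E `^ (- (5 / 2)) * (K2 + K2))//; ring.
(* [Is] and [vs] become the outer variables, so that the integral over omega, q, r is taken with the
   energy frozen. *)
rewrite /collision_measure sigma_prod_tonelli2//.
apply: (@le_trans _ _ (\int[leb]_Is \int[@leb3 R]_vs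
    ((A vs Is * energy v I vs Is `^ (- (5 / 2)))%:E * ((K2 + K2)%:E * IG)))%E).
  apply: ge0_le_integralT => Is; first exact: integral_ge0.
  rewrite sigma_prod_tonelli2//; last first.
    by apply: (measurableT_comp mH); exact: measurable_fun_pair.
  by apply: ge0_le_integralT => vs; [exact: integral_ge0|exact: inner].
have mAE : measurable_fun setT (fun z : mV * mR =>
    (A z.1 z.2 * energy v I z.1 z.2 `^ (- (5 / 2)))%:E).
  apply/measurable_EFinP; apply: measurable_funM => //.
  by apply: measurable_powRr; exact: measurable_energy.
have AE0 vs Is : (0 <= (A vs Is * energy v I vs Is `^ (- (5 / 2)))%:E)%E.
  by rewrite lee_fin mulr_ge0 ?powR_ge0.
have KIG0 : (0 <= (K2 + K2)%:E * IG)%E by rewrite mule_ge0// lee_fin addr_ge0 ?(ltW K20).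
apply: (@le_trans _ _ (\int[leb]_Is ((\int[@leb3 R]_vs
    (A vs Is * energy v I vs Is `^ (- (5 / 2)))%:E) * ((K2 + K2)%:E * IG)))%E).
  rewrite le_eqVlt; apply/orP; left; apply/eqP; apply: eq_integral => Is _.
  rewrite ge0_integralZr//.
  have mp : measurable_fun [set: mV] (fun vs : mV => (vs, Is) : mV * mR).
    exact: measurable_fun_pair.
  exact: (measurableT_comp mAE mp).
rewrite ge0_integralZr//; last 2 first.
- exact: (measurable_fun_fubini_tonelli_G (m1 := @leb3 R) _ mAE).
- by move=> Is _; exact: integral_ge0.
apply: (le_trans (lee_wpmul2r KIG0 (K1P v I I0))).
by rewrite muleA -EFinM mulrAC.
Qed.

End gain_bound.

(** * From the gain integral to the weighted gain term *)

Section Gamma_plus_bound.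
Context {R : realType}.
Local Notation mR := (measurableTypeR R).
Local Notation leb := (@lebesgue_measure R).
Local Notation mV := (mR * mR * mR)%type.

Lemma Gamma_plus_le (alpha delta CB beta : R) :
  0 <= alpha -> alpha < 2 -> 2 <= delta -> 0 < CB -> 0 <= beta ->
  exists2 K : R, 0 < K &
  forall (f : R -> R * R * R -> R * R * R -> R -> R) t x (L : R) (g : mV * mR -> \bar R) v I,
  0 <= L -> 0 < I -> measurable_fun setT g -> (forall y, 0 <= g y)%E ->
  majorant beta L (f t x) g ->
  (`| (weight beta v I)%:E * Gamma_plus alpha delta CB f f t x v I | <=
   (K / (1 + norm3 v + I `^ 4^-1))%:E * \int[@leb3 R \xs leb]_y g y)%E.
Proof.
move=> al0 al2 d2 CB0 b0.
have a0 : 0 <= (delta / 2 - 1) / 2 by lra.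
have [K K0 KP] := collision_integral_le al0 al2 a0.
have [c c0 cE] : exists2 c : R, 0 < c & CB * (Num.sqrt (maxwellian_cst delta) + 1) * 3 `^ beta = c.
  exists (CB * (Num.sqrt (maxwellian_cst delta) + 1) * 3 `^ beta) => //.
  by rewrite !mulr_gt0 ?powR_gt0// ltr_wpDl ?sqrtr_ge0.
exists (c * K) => [|f t x L g v I L0 I0 mg g0 fg]; first exact: mulr_gt0.
rewrite /Gamma_plus /=.
set m := (Num.sqrt (maxwellian delta v I))^-1; set w := weight beta v I.
set Q := Qplus _ _ _ _ _ _ _ _ _.
have w0 : 0 < w by rewrite powR_gt0// ltr_wpDr ?sqrtr_ge0// ltr_wpDr ?norm3_ge0.
have m0 : 0 <= m by rewrite invr_ge0 sqrtr_ge0.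
set IG := (\int[@leb3 R \xs leb]_y g y)%E.
have IG0 : (0 <= IG)%E by exact: integral_ge0.
set D := 1 + norm3 v + I `^ 4^-1.
have D0 : 0 < D by rewrite ltr_wpDr ?powR_ge0// ltr_wpDr ?norm3_ge0.
(* [m] is 0 only if the root of the Maxwellian is, by the convention for the inverse of 0; then the
   left-hand side vanishes. *)
have [mz|mnz] := eqVneq m 0.
  by rewrite mz mul0e mule0 abse0 mule_ge0// lee_fin divr_ge0 ?mulr_ge0 ?(ltW c0) ?(ltW K0) ?(ltW D0).
have mp : 0 < m by rewrite lt_neqAle eq_sym mnz.
have wm0 : 0 < w * m by exact: mulr_gt0.
(* The prefactors w and m stand outside the integral while the pointwise bound contains them. It is
   divided by w m, and the resulting constant is absorbed into [g]. *)
pose k := (w * m)^-1 * c.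
have k0 : 0 < k by rewrite mulr_gt0 ?invr_gt0.
pose g' y := (k%:E * g y)%E.
have mg' : measurable_fun setT g' by exact: emeasurable_funM.
have g'0 y : (0 <= g' y)%E by rewrite mule_ge0// lee_fin ltW.
have IGE : (\int[@leb3 R \xs leb]_y g' y = k%:E * IG)%E.
  by rewrite ge0_integralZl// lee_fin ltW.
have := KP v I g' I0 mg' g'0; rewrite IGE => Hle.
have Qle : (`|Q| <= (K / D)%:E * (k%:E * IG))%E.
  apply: le_trans Hle; apply: abse_integral_le => [p|p].
    apply: mule_ge0; last by rewrite adde_ge0.
    have [/andP[_ q1]|_] := boolP (0 < p.1.1.2.1 <= 1); last by rewrite mulr0 mul0r mulr0.
    by rewrite lee_fin !mulr_ge0 ?powR_ge0 ?expR_ge0 ?sqrtr_ge0 ?subr_ge0.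
  case: p => [[[om [q r]] vs] Is] /= [[[/= om1 [/= q01 r01]] _] /= Is0].
  move: q01 r01 Is0; rewrite !in_itv/= andbT => q01 r01 Is0.
  have := @sqrtM_gain_le R alpha delta CB beta L f g t x v I om q r vs Is
    d2 (ltW CB0) b0 L0 fg g0 I0 Is0 om1 q01 r01.
  set Gn := gain_integrand _ _ _ _ _ _ _ _ _ _ _ _ _ _; rewrite -/m -/w cE.
  set A := energy _ _ _ _ `^ _ * _; set g1 := g _; set g2 := g _.
  move=> /(lee_wpmul2l (x := (w * m)^-1%:E)); rewrite lee_fin invr_ge0 (ltW wm0) => /(_ isT).
  rewrite muleA -!EFinM normrM (ger0_norm m0) (mulrA w) mulKf ?gt_eqF// => /le_trans; apply.
  rewrite Is0 mul1r /g' -ge0_muleDr// !muleA -!EFinM; apply: lee_wpmul2r.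
    by apply: adde_ge0; exact: g0.
  rewrite lee_fin om1 ltr01 mulr1 /k.
  have [->|qn0] := eqVneq q 0; first by rewrite sqrtr0 !(mul0r, mulr0).
  move: q01 => /andP[q0 ->]; rewrite lt_neqAle eq_sym qn0 q0 mulr1.
  by rewrite le_eqVlt; apply/orP; left; apply/eqP; ring.
rewrite !abseM (gee0_abs (x := w%:E)) ?(gee0_abs (x := m%:E)) ?lee_fin// ?(ltW w0)//.
rewrite muleA -EFinM; apply: (le_trans (lee_wpmul2l _ Qle)); first by rewrite lee_fin ltW.
rewrite !muleA -!EFinM; apply: lee_wpmul2r => //; rewrite lee_fin /k.
rewrite (_ : w * m * (K / D) * ((w * m)^-1 * c) = (c * K / D) * ((w * m) * (w * m)^-1)); last by ring.
by rewrite mulfV ?mulr1// gt_eqF.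
Qed.

End Gamma_plus_bound.

(** * The weighted Cauchy-Schwarz inequality *)

Section weighted_Cauchy_Schwarz.
Context {R : realType}.
Local Notation mR := (measurableTypeR R).
Local Notation leb := (@lebesgue_measure R).
Local Notation mV := (mR * mR * mR)%type.
Local Notation mu := (@leb3 R \xs @lebesgue_measure R)%E.

Definition bracket (y : mV * mR) : R := 1 + norm3 y.1 + Num.sqrt y.2.

Lemma bracket_gt0 y : 0 < bracket y.
Proof. by rewrite ltr_wpDr ?sqrtr_ge0// ltr_wpDr ?norm3_ge0. Qed.

Lemma measurable_bracket : measurable_fun setT bracket.
Proof.
apply: measurable_funD; last by apply: measurable_sqrtr; exact: measurable_snd.
by apply: measurable_funD => //; exact: (measurableT_comp (@measurable_norm3 R)).
Qed.

(** Each 1 + |v_i| is at most the bracket and 1 + I is at most its square, so the four factors use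
    the exponent 3 (3/2) + 2 (3/2) = 15/2, which is below 8. *)
Lemma bracket_decay y : 0 < y.2 ->
  bracket y `^ (- 8) <= decay y.1.1.1 * decay y.1.1.2 * decay y.1.2 * decay y.2.
Proof.
move=> y0; have B0 := bracket_gt0 y.
have B1 : 1 <= bracket y by rewrite /bracket -addrA lerDl addr_ge0 ?norm3_ge0 ?sqrtr_ge0.
have coord (z : R) : z ^+ 2 <= norm3 y.1 ^+ 2 -> 1 + `|z| <= bracket y.
  move=> z2; have : `|z| <= norm3 y.1.
    by rewrite -ler_sqr ?nnegrE ?norm3_ge0// real_normK ?num_real.
  by have := sqrtr_ge0 y.2; rewrite /bracket; lra.
have sq := sqr_norm3 y.1.
have s1 := sqr_ge0 y.1.1.1; have s2 := sqr_ge0 y.1.1.2; have s3 := sqr_ge0 y.1.2.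
have h1 : 1 + `|y.1.1.1| <= bracket y by apply: coord; rewrite sq; lra.
have h2 : 1 + `|y.1.1.2| <= bracket y by apply: coord; rewrite sq; lra.
have h3 : 1 + `|y.1.2| <= bracket y by apply: coord; rewrite sq; lra.
have h4 : 1 + `|y.2| <= bracket y ^+ 2.
  rewrite gtr0_norm// -[X in 1 + X](sqr_sqrtr (ltW y0)).
  have := norm3_ge0 y.1; have := sqrtr_ge0 y.2; rewrite /bracket; nra.
have dec (z X : R) : 0 < X -> 1 + `|z| <= X -> X `^ (- (3 / 2)) <= decay z.
  move=> X0 zX; rewrite /decay !powRN lef_pV2 ?posrE ?powR_gt0 ?ltr_pwDl//.
  by rewrite ge0_ler_powR ?nnegrE ?addr_ge0 ?(ltW X0).
apply: (@le_trans _ _ (bracket y `^ (- (3 / 2)) * bracket y `^ (- (3 / 2)) *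
    bracket y `^ (- (3 / 2)) * (bracket y ^+ 2) `^ (- (3 / 2)))).
  rewrite -powR_mulrn ?(ltW B0)// -powRrM !powRDgt0// ler_powR//; lra.
by rewrite !ler_pM ?mulr_ge0 ?powR_ge0 ?dec ?exprn_gt0.
Qed.

Lemma integral_bracket_fin : exists2 K : R, 0 < K &
  (\int[mu]_y ((0 < y.2)%R%:R * bracket y `^ (- 8))%:E <= K%:E)%E.
Proof.
have [K KP] := @integral_decay_fin R.
pose d (x : mR) := (decay x)%:E.
have md : measurable_fun setT d by apply/measurable_EFinP; exact: measurable_decay.
have d0 x : (0 <= d x)%E by rewrite lee_fin decay_ge0.
have K0 : 0 <= K by rewrite -lee_fin; apply: le_trans KP; apply: integral_ge0 => x _; exact: d0.
exists (K * K * K * K + 1); first by rewrite ltr_wpDl ?mulr_ge0.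
have mP : measurable_fun setT (fun z : mV => d z.1.1 * d z.1.2 * d z.2)%E.
  apply: emeasurable_funM; first apply: emeasurable_funM.
  - exact: (measurableT_comp md (measurableT_comp measurable_fst measurable_fst)).
  - exact: (measurableT_comp md (measurableT_comp measurable_snd measurable_fst)).
  - exact: (measurableT_comp md measurable_snd).
apply: (@le_trans _ _ (\int[mu]_y (d y.1.1.1 * d y.1.1.2 * d y.1.2 * d y.2))%E).
  apply: ge0_le_integralT => y; first by rewrite lee_fin mulr_ge0 ?powR_ge0.
  have [y0|_] := boolP (0 < y.2); first by rewrite mul1r -!EFinM lee_fin bracket_decay.
  by rewrite mul0r !mule_ge0.
rewrite sigma_prod_tonelli2 => [||y]; last by rewrite !mule_ge0.
  set P := (\int[leb]_x d x * \int[leb]_x d x * \int[leb]_x d x)%E.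
  have I0 : (0 <= \int[leb]_x d x)%E by exact: integral_ge0.
  have P0 : (0 <= P)%E by rewrite !mule_ge0.
  apply: (@le_trans _ _ (\int[leb]_x (P * d x))%E).
    rewrite le_eqVlt; apply/orP; left; apply/eqP; apply: eq_integral => x _ /=.
    by rewrite ge0_integralZr ?leb3_integral_prod// => z _; rewrite !mule_ge0.
  rewrite ge0_integralZl//; apply: (@le_trans _ _ (K * K * K * K)%:E).
    by rewrite !EFinM; do 3?[apply: lee_pmul => //; rewrite ?mule_ge0//].
  by rewrite lee_fin lerDl.
apply: emeasurable_funM; last exact: (measurableT_comp md measurable_snd).
exact: (measurableT_comp mP measurable_fst).
Qed.

(** With B = [bracket], split |h| = (B^4 |h|) B^(-4) and apply Hoelder's inequality with exponents 2
    and 2. Since the weight is B^beta, the square B^8 h^2 equals B^(-2 beta + 8) times the square of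
    the weighted h. *)
Lemma L1_le_weighted_L2 (beta : R) : exists2 K : R, 0 < K &
  forall h : mV * mR -> R, measurable_fun ([set: mV] `*` (`]0, +oo[%classic : set mR)) h ->
  (\int[mu]_y ((0 < y.2)%R%:R * `|h y|)%:E <=
   K%:E * (\int[mu]_(y in [set: mV] `*` (`]0%R, +oo[%classic : set mR))
     ((1 + norm3 y.1 + Num.sqrt y.2) `^ (- 2 * beta + 8) *
      `|weight beta y.1 y.2 * h y| ^+ 2)%:E) `^ 2^-1)%E.
Proof.
have [K K0 KP] := integral_bracket_fin.
exists (K `^ 2^-1) => [|h mh]; first exact: powR_gt0.
pose D : set (mV * mR) := [set: mV] `*` (`]0, +oo[%classic : set mR).
have mD : measurable D by apply: measurableX => //; exact: measurable_itv.
have DE y : (y \in D) = (0 < y.2).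
  by apply/idP/idP; rewrite inE /D /= in_itv/= andbT => //; case.
pose F := (fun y => bracket y `^ 4 * `|h y|) \_ D.
pose G y := (0 < y.2)%R%:R * bracket y `^ (- 4).
have mF : measurable_fun setT F.
  have mW : measurable_fun D (fun y => bracket y `^ 4 * `|h y|).
    apply: measurable_funM; last exact: measurableT_comp.
    exact: measurable_funTS (measurable_powRr 4 measurable_bracket).
  exact: (measurable_restrictT _ mD).1 mW.
have mG : measurable_fun setT G.
  apply: measurable_funM; last exact: measurable_powRr measurable_bracket.
  by apply: measurable_bool_natr; exact: measurable_fun_ltr.
have h2 : 2^-1 + 2^-1 = 1 :> R by field.
have p2 : 0 < 2 :> R by [].
have := hoelder mu mF mG p2 p2 h2.
rewrite Lnorm1 => H.
have {H} : (\int[mu]_y ((0 < y.2)%R%:R * `|h y|)%:E <= 'N[mu]_2%:E[EFin \o F] * 'N[mu]_2%:E[EFin \o G])%E.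
  apply: le_trans H; rewrite le_eqVlt; apply/orP; left; apply/eqP; apply: eq_integral => y _ /=.
  rewrite /F /G patchE DE; case: ifPn => y0; last by rewrite !mul0r normr0.
  rewrite !mul1r mulrAC powRDgt0 ?bracket_gt0// subrr powRr0 mul1r.
  by rewrite normr_id.
move=> /le_trans; apply; rewrite muleC; apply: lee_pmul; rewrite ?Lnorm_ge0//.
  rewrite unlock -poweR_EFin; apply: gt0_ler_poweR; rewrite ?invr_ge0//.
  - by rewrite in_itv/= leey andbT; apply: integral_ge0 => y _; rewrite lee_fin powR_ge0.
  - by rewrite in_itv/= leey andbT lee_fin ltW.
  apply: le_trans KP; rewrite le_eqVlt; apply/orP; left; apply/eqP; apply: eq_integral => y _.
  rewrite /G /= powR_mulrn// real_normK ?num_real// exprMn.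
  rewrite [bracket y `^ _ ^+ 2]expr2 powRDgt0 ?bracket_gt0// (_ : - 4 + - 4 = - 8 :> R); last by ring.
  by case: (0 < y.2); rewrite ?expr1n ?expr0n.
rewrite unlock le_eqVlt; apply/orP; left; apply/eqP; congr (_ `^ _)%E.
rewrite [RHS]integral_mkcond; apply: eq_integral => y _.
rewrite /F /= powR_mulrn// real_normK ?num_real// !patchE -/D.
case: ifPn => _; last by rewrite expr0n.
congr EFin; rewrite /weight -/(bracket y) normrM !exprMn [RHS]mulrA.
congr (_ * _).
have B0 := bracket_gt0 y.
rewrite (ger0_norm (powR_ge0 _ _)) -!powR_mulrn ?powR_ge0// -!powRrM powRDgt0//.
by congr (_ `^ _); ring.
Qed.

End weighted_Cauchy_Schwarz.

(** * Null sets in products and their sections *)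

Section sigma_prod_null_sets.
Context d1 d2 (T1 : measurableType d1) (T2 : measurableType d2) (R : realType).
Variables (m1 : {sigma_finite_measure set T1 -> \bar R})
          (m2 : {sigma_finite_measure set T2 -> \bar R}) (A : set T1) (B : set T2).
Hypotheses (mA : measurable A) (mB : measurable B).

Let sigma_prodE : ((m1 \xs m2) (A `*` B) = m1 A * m2 B)%E.
Proof. exact: product_measure1E. Qed.

Lemma sigma_prod_nulll : m1 A = 0%E -> (m1 \xs m2)%E (A `*` B) = 0%E.
Proof. by move=> A0; rewrite sigma_prodE A0 mul0e. Qed.

Lemma sigma_prod_nullr : m2 B = 0%E -> (m1 \xs m2)%E (A `*` B) = 0%E.
Proof. by move=> B0; rewrite sigma_prodE B0 mule0. Qed.

End sigma_prod_null_sets.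

Section null_sections.
Context {R : realType}.
Local Notation mR := (measurableTypeR R).
Local Notation leb := (@lebesgue_measure R).
Local Notation mV := (mR * mR * mR)%type.

(** The bound on f fails on a null set of points (x, v, I), but the gain term at x involves all of
    f(t, x, .), so the exceptional set must be null in (v, I) for almost every x. Integrating its
    indicator by Tonelli's theorem gives a nonnegative function of x with integral 0. *)
Lemma ae_null_section (A : set (mV * mV * mR)) : measurable A ->
  (@leb3 R \xs @leb3 R \xs leb)%E A = 0%E ->
  \forall x \ae @leb3 R, (@leb3 R \xs leb)%E [set y | A (x, y.1, y.2)] = 0%E.
Proof.
move=> mA A0.
pose F (z : mV * mV * mR) : \bar R := (\1_A z)%:E.
have mF : measurable_fun setT F by apply/measurable_EFinP; exact: measurable_indic.
have F0 z : (0 <= F z)%E by rewrite lee_fin.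
have IF0 : (\int[@leb3 R \xs @leb3 R \xs leb]_z F z = 0)%E.
  by rewrite integral_indic// setIT.
pose F2 (p : mV * mV) : \bar R := (\int[leb]_I F (p, I))%E.
have mF2 : measurable_fun setT F2 by exact: (measurable_fun_fubini_tonelli_F (m2 := leb) _ mF).
have F20 p : (0 <= F2 p)%E by exact: integral_ge0.
pose F3 (x : mV) : \bar R := (\int[@leb3 R]_v F2 (x, v))%E.
have mF3 : measurable_fun setT F3.
  exact: (measurable_fun_fubini_tonelli_F (m2 := @leb3 R) _ mF2).
have F30 x : (0 <= F3 x)%E by exact: integral_ge0.
have IF3 : (\int[@leb3 R]_x `|F3 x| = 0)%E.
  under eq_integral do rewrite gee0_abs//.
  rewrite -IF0 (sigma_prod_tonelli1 _ _ mF F0); apply/esym.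
  exact: (sigma_prod_tonelli1 _ _ mF2 F20).
have /(ae_eq_integral_abs _ measurableT mF3) := IF3.
apply: filterS => x /(_ Logic.I) /= F3x0.
have msec : measurable_fun setT (fun y : mV * mR => (x, y.1, y.2) : mV * mV * mR).
  by apply: measurable_fun_pair => //; exact: measurable_fun_pair.
have mN : measurable [set y : mV * mR | A (x, y.1, y.2)].
  by rewrite -[X in measurable X]setTI; exact: msec.
rewrite -[RHS]F3x0 -(setIT [set y | A _]) -integral_indic//.
rewrite sigma_prod_tonelli1//; last by apply/measurable_EFinP; exact: measurable_indic.
Qed.

Lemma phase_ae_fst (P : mV -> Prop) :
  (\forall x \ae @leb3 R, P x) -> \forall z \ae @phase_measure R, P z.1.1.
Proof.
move=> [N [mN N0 PN]].
exists ((N `*` [set: mV]) `*` [set: mR]); split.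
- by apply: measurableX => //; exact: measurableX.
- apply/eqP; rewrite eq_le measure_ge0 andbT.
  rewrite /phase_measure /mrestr.
  have mNTT : measurable ((N `*` [set: mV]) `*` [set: mR]).
    by apply: measurableX => //; exact: measurableX.
  apply: (@le_trans _ _ ((@leb3 R \xs @leb3 R \xs leb)%E ((N `*` [set: mV]) `*` [set: mR]))).
    apply: le_measure; rewrite ?inE//.
    by apply: measurableI => //; exact: measurable_phase_domain.
  have -> : (@leb3 R \xs @leb3 R \xs leb)%E ((N `*` [set: mV]) `*` [set: mR]) = 0%E => //.
  apply: sigma_prod_nulll => //; first exact: measurableX.
  exact: sigma_prod_nulll.
- by move=> z /= Pz; split => //; split => //; exact: PN.
Qed.

Lemma phase_ae_domain : \forall z \ae @phase_measure R, phase_domain z.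
Proof.
exists (~` phase_domain); split => //.
- by apply: measurableC; exact: measurable_phase_domain.
- by rewrite /phase_measure /mrestr setICl measure0.
Qed.

Lemma null_zero_section : (@leb3 R \xs leb)%E ([set: mV] `*` ([set 0] : set mR)) = 0%E.
Proof.
by apply: sigma_prod_nullr => //; exact: lebesgue_measure_set1.
Qed.

End null_sections.

(** * The majorant at fixed (t, x) and the final estimate *)

Section main_estimate.
Context {R : realType}.
Local Notation mR := (measurableTypeR R).
Local Notation leb := (@lebesgue_measure R).
Local Notation mV := (mR * mR * mR)%type.
Local Notation mu := (@leb3 R \xs @lebesgue_measure R)%E.

Lemma weighted_Linfty_ae (beta : R) (f : R -> R * R * R -> R * R * R -> R -> R) t :
  (weighted_Linfty beta f t < +oo)%E -> exists2 L : R, 0 <= L /\ weighted_Linfty beta f t = L%:E &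
  \forall z \ae @phase_measure R, weight beta z.1.2 z.2 * `|f t z.1.1 z.1.2 z.2| <= L.
Proof.
move=> Loo; have L0 : (0 <= weighted_Linfty beta f t)%E by exact: Lnorm_ge0.
have Lfin : weighted_Linfty beta f t \is a fin_num by rewrite ge0_fin_numE.
exists (fine (weighted_Linfty beta f t)); first by rewrite fine_ge0// fineK.
(* The norm of exponent +oo is an essential supremum only for a measure of positive mass; for mass 0
   every property holds almost everywhere. *)
have [m0|] := ltP 0%E (@phase_measure R setT); last first.
  move=> mle0; have m0 : @phase_measure R setT = 0%E.
    by apply/eqP; rewrite eq_le mle0 measure_ge0.
  by exists setT; split.
have LE : weighted_Linfty beta f t = ess_sup (@phase_measure R) (fun z =>
    `|(weight beta z.1.2 z.2 * f t z.1.1 z.1.2 z.2)%:E|%E).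
  by rewrite /weighted_Linfty unlock m0.
have := ess_sup_ge (@phase_measure R) (fun z =>
    `|(weight beta z.1.2 z.2 * f t z.1.1 z.1.2 z.2)%:E|%E).
rewrite -LE; apply: filterS => z /=.
by rewrite -[X in (_ <= X)%E]fineK// lee_fin normrM (ger0_norm (powR_ge0 _ _)).
Qed.

(** The function [g] for h = f(t, x, .), where N is the section at x of the exceptional set. The
    value +oo on N and on I = 0 avoids any discussion of preimages of null sets under the collision
    map. *)
Definition section_majorant (L : R) (N : set (mV * mR)) (h : mV * mR -> R) (y : mV * mR) : \bar R :=
  if (y.2 == 0) || (y \in N) then +oo%E else ((0 < y.2)%R%:R * (L * `|h y|))%:E.

Variables (L : R) (N : set (mV * mR)) (h : mV * mR -> R).
Hypotheses (L0 : 0 <= L) (mN : measurable N).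
Hypothesis mh : measurable_fun ([set: mV] `*` (`]0, +oo[%classic : set mR)) h.

Lemma section_majorant_ge0 y : (0 <= section_majorant L N h y)%E.
Proof.
by rewrite /section_majorant; case: ifP => _; rewrite ?leey// lee_fin !mulr_ge0.
Qed.

Let hpos (y : mV * mR) : R := (0 < y.2)%R%:R * `|h y|.

Let measurable_hpos : measurable_fun setT hpos.
Proof.
pose D : set (mV * mR) := [set: mV] `*` (`]0, +oo[%classic : set mR).
have mD : measurable D by apply: measurableX => //; exact: measurable_itv.
have -> : hpos = (fun y => `|h y|) \_ D.
  apply/funext => y; rewrite patchE /hpos; case: ifPn => [|/negP]; rewrite inE /D /= in_itv/= andbT.
    by move=> [_ ->]; rewrite mul1r.
  by move=> y0; rewrite (_ : 0 < y.2 = false) ?mul0r//; apply/negP => ?; exact: y0.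
by apply: (measurable_restrictT _ mD).1; exact: measurableT_comp.
Qed.

Lemma measurable_section_majorant : measurable_fun setT (section_majorant L N h).
Proof.
apply: measurable_fun_ifT => //.
- apply: (measurable_fun_bool true); rewrite setTI.
  rewrite (_ : _ @^-1` _ = [set: mV] `*` ([set 0] : set mR) `|` N).
    by apply: measurableU => //; apply: measurableX => //; exact: measurable_set1.
  apply/seteqP; split => y /=; first by move=> /orP[/eqP ->|]; [left|rewrite inE; right].
  by move=> [[_ ->]|Ny]; rewrite ?eqxx// (mem_set Ny) orbT.
- apply/measurable_EFinP.
  rewrite (_ : (fun y => _) = (fun y => L * hpos y)); first exact: measurable_funM.
  by apply/funext => y; rewrite /hpos mulrCA.
Qed.

(** The two integrands differ only on N and on I = 0, both of which are null. *)
Lemma integral_section_majorant : mu N = 0%E ->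
  (\int[mu]_y section_majorant L N h y = L%:E * \int[mu]_y (hpos y)%:E)%E.
Proof.
move=> N0.
have mEh : measurable_fun setT (fun y => (hpos y)%:E) by exact/measurable_EFinP.
have h0 y : (0 <= (hpos y)%:E)%E by rewrite lee_fin mulr_ge0.
rewrite -ge0_integralZl//; apply: ge0_ae_eq_integral => //.
- exact: measurable_section_majorant.
- exact: emeasurable_funM.
- by move=> y _; exact: section_majorant_ge0.
- by move=> y _; rewrite mule_ge0.
have aeN : \forall y \ae mu, ~ N y.
  by exists N; split => // y /= /contrapT.
have ae0 : \forall y \ae mu, y.2 != 0.
  exists ([set: mV] `*` ([set 0] : set mR)); split.
  - by apply: measurableX => //; exact: measurable_set1.
  - exact: null_zero_section.
  - by move=> y /= /negP; rewrite negbK => /eqP.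
apply: filterS2 aeN ae0 => y Ny y0 _; rewrite /section_majorant (negbTE y0) /=.
by case: ifPn => [|_]; [rewrite inE|rewrite /hpos -EFinM mulrCA].
Qed.

End main_estimate.

Theorem lemma2p2 (R : realType) (alpha delta CB beta : R)
  (halpha0 : 0 <= alpha) (halpha2 : alpha < 2) (hdelta : 2 <= delta)
  (hCB : 0 < CB) (hbeta : 7 < beta) :
  exists C : R, 0 < C /\
  forall f : R -> R * R * R -> R * R * R -> R -> R,
    measurable_fun
      [set z : R * (R * R * R) * (R * R * R) * R | 0 <= z.1.1.1 /\ 0 < z.2]
      (fun z : R * (R * R * R) * (R * R * R) * R =>
         f z.1.1.1 z.1.1.2 z.1.2 z.2) ->
    torus_periodic f ->
    forall t : R, 0 <= t -> (weighted_Linfty beta f t < +oo)%E ->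
    \forall z \ae @phase_measure R,
      let x := z.1.1 in let v := z.1.2 in let I := z.2 in
      (`| (weight beta v I)%:E * Gamma_plus alpha delta CB f f t x v I |
       <= (C / (1 + norm3 v + I `^ 4^-1))%:E * weighted_Linfty beta f t *
          (\int[@leb3 R \xs @lebesgue_measure R]_(q in setT `*` `]0%R, +oo[)
             ((1 + norm3 q.1 + Num.sqrt q.2) `^ (- 2 * beta + 8) *
              `| weight beta q.1 q.2 * f t x q.1 q.2 | ^+ 2)%:E) `^ 2^-1)%E.
Proof.
have b0 : 0 <= beta by lra.
have [K1 K10 K1P] := Gamma_plus_le halpha0 halpha2 hdelta hCB b0.
have [K2 K20 K2P] := L1_le_weighted_L2 beta.
exists (K1 * K2); split=> [|f mf _ t t0 Loo]; first exact: mulr_gt0.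
have [L [L0 LE] [A [mA A0 PA]]] := weighted_Linfty_ae Loo.
have mP : measurable (A `&` phase_domain).
  by apply: measurableI => //; exact: measurable_phase_domain.
(* [phase_measure] is a restriction, so [A0] says by definition that the part of [A] inside
   [phase_domain] is null for the product measure. *)
have sec := ae_null_section mP A0.
(* Only x has to avoid a null set: once x lies in the cube and its section is null, the estimate is
   proved for all v and all I > 0. *)
apply: filterS2 phase_ae_domain (phase_ae_fst sec) => z Dz Nz /=.
rewrite LE; move: z Dz Nz => [[x v] I] /= [[xc _] I0] Nz.
rewrite /= in_itv/= andbT in I0.
pose mV := (measurableTypeR R * measurableTypeR R * measurableTypeR R)%type.
pose N : set (mV * measurableTypeR R) := [set y | (A `&` phase_domain) (x, y.1, y.2)].
have mN : measurable N.
  have msec : measurable_fun [set: mV * measurableTypeR R]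
      (fun y => (x, y.1, y.2) : mV * mV * measurableTypeR R).
    by apply: measurable_fun_pair => //; exact: measurable_fun_pair.
  by rewrite -[N]setTI; exact: msec.
have {}Nz : (@leb3 R \xs @lebesgue_measure R)%E N = 0%E by exact: Nz.
pose h (y : mV * measurableTypeR R) : measurableTypeR R := f t x y.1 y.2.
pose Df : set (measurableTypeR R * mV * mV * measurableTypeR R) :=
  [set z | 0 <= z.1.1.1 /\ 0 < z.2].
have mDf : measurable Df.
  rewrite (_ : Df = (`[0, +oo[%classic `*` setT) `*` setT `*` `]0, +oo[%classic).
    apply: measurableX; last exact: measurable_itv.
    by apply: measurableX => //; apply: measurableX => //; exact: measurable_itv.
  apply/seteqP; split => y; rewrite /Df /= !in_itv/= !andbT; first by case.
  by case=> [[[]]].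
have mh : measurable_fun ([set: mV] `*` (`]0, +oo[%classic : set (measurableTypeR R))) h.
  have mt : measurable_fun ([set: mV] `*` (`]0, +oo[%classic : set (measurableTypeR R)))
      (fun y => (t, x, y.1, y.2) : measurableTypeR R * mV * mV * measurableTypeR R).
    apply: measurable_funTS; apply: measurable_fun_pair => //.
    exact: measurable_fun_pair.
  apply: (measurable_comp mDf _ mf mt).
  by move=> _ [y [_ /= y0] <-]; rewrite /Df /=; split => //; move: y0; rewrite in_itv/= andbT.
(* A point off [N] with I' > 0 lies in the phase domain, because x is in the cube; hence it is off
   [A], where the bound by L holds. *)
have maj : majorant beta L (f t x) (section_majorant L N h).
  move=> v' I' I'0; rewrite /section_majorant /=.
  have [_|I'n0] := eqVneq I' 0; first by left.
  case: ifPn => [_|]; first by left.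
  rewrite /= notin_setE => nN; right.
  have I'p : 0 < I' by rewrite lt_neqAle eq_sym I'n0.
  rewrite I'p mul1r; split => //.
  have [//|nle] := boolP (weight beta v' I' * `|f t x v' I'| <= L).
  exfalso; apply: nN; rewrite /N /=; split; first by apply: PA => /=; exact/negP.
  by split; [split|rewrite /= in_itv/= I'p].
have := K1P f t x L (section_majorant L N h) v I L0 I0
  (measurable_section_majorant L mN mh) (section_majorant_ge0 N h L0) maj.
move=> /le_trans; apply; rewrite (integral_section_majorant L0 mN mh Nz).
have D0 : 0 < 1 + norm3 v + I `^ 4^-1.
  by rewrite ltr_wpDr ?powR_ge0// ltr_wpDr ?norm3_ge0.
have KD0 : 0 <= K1 / (1 + norm3 v + I `^ 4^-1) by rewrite divr_ge0// ltW.
apply: (le_trans (lee_wpmul2l _ (lee_wpmul2l _ (K2P h mh)))); rewrite ?lee_fin//.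
rewrite !muleA -!EFinM (_ : K1 / _ * L * K2 = K1 * K2 / (1 + norm3 v + I `^ 4^-1) * L)//.
by ring.
Qed.
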